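(* Let $(X,\Sigma,\mu)$ be a complete $\sigma$-finite measure space and let $\mathcal{A}\subseteq\Sigma$ be a $\sigma$-subalgebra such that $(X,\mathcal{A},\mu|_{\mathcal{A}})$ is $\sigma$-finite. Write $X=\left(\bigcup_{i=1}^{\infty}A_i\right)\cup B$, a disjoint union in which $\{A_i\}$ are pairwise disjoint $\mathcal{A}$-atoms and $B\in\mathcal{A}$ is non-atomic (contains no $\mathcal{A}$-atom). Let $1\le q<p<\infty$, let $p'$ be defined by $\frac1p+\frac1{p'}=1$, and let $r$ be defined by $\frac1p+\frac1r=\frac1q$. Let $T=M_wEM_u:L^p(\Sigma)\to L^q(\Sigma)$, $Tf=w\cdot E(uf)$, be a bounded weighted conditional expectation operator. Then $T$ is nuclear if and only if both of the following hold: (i) $\left(E(|u|^{p'})\right)^{1/p'}\left(E(|w|^{q})\right)^{1/q}=0$ $\mu$-a.e. on $B$; (ii) $\displaystyle\sum_{i=1}^{\infty}\left(E(|u|^{p'})(A_i)\right)^{1/p'}\left(E(|w|^q)(A_i)\right)^{1/q}\left(\mu(A_i)\right)^{1/r}<\infty$.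
   Context: All statements about sets and functions are up to sets of measure zero; functions are complex-valued. $L^p(\Sigma)=L^p(X,\Sigma,\mu)$, and $L^0(\mu)$ is the space of measurable functions. $E=E^{\mathcal{A}}$ is the conditional expectation with respect to $\mathcal{A}$: $E(f)$ is the unique $\mathcal{A}$-measurable function with $\int_A E(f)\,d\mu=\int_A f\,d\mu$ for all $A\in\mathcal{A}$; it is defined for all measurable $f\ge 0$ (with values in $[0,\infty]$), for all $f\in L^p(\Sigma)$, and more generally for conditionable $f$, i.e. measurable $f$ with $E(|f|)<\infty$ a.e. (by linear extension). An $\mathcal{A}$-atom is a set $A\in\mathcal{A}$ with $\mu(A)>0$ such that every $F\in\mathcal{A}$ with $F\subseteq A$ has $\mu(F)=0$ or $\mu(F)=\mu(A)$. An $\mathcal{A}$-measurable function $h$ is a.e. constant on an $\mathcal{A}$-atom $A$; $h(A)$ denotes that constant. The family of atoms is countable (finite or infinite). The convention $0\cdot\infty=0$ is used. Weighted conditional expectation (WCE) operator: given $w,u\in L^0(\mu)$ such that $uf$ is conditionable for every $f\in L^p(\Sigma)$, $T=M_wEM_u$ is the linear map $T(f)=w\cdot E(uf)$. A bounded operator $T:Y\to Z$ between Banach spaces is nuclear if there are $(f_n)\subset Y^*$ and $(z_n)\subset Z$ with $\sum_{n=1}^\infty\|f_n\|\,\|z_n\|<\infty$ and $Ty=\sum_{n=1}^\infty f_n(y)z_n$ for all $y\in Y$. *)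

(* Defs.v *)
From HB Require Import structures.
From mathcomp Require Import all_boot all_order all_algebra.
From mathcomp Require Import generic_quotient ring_quotient complex.
From mathcomp Require Import all_classical all_reals all_analysis.
From mathcomp Require Import measurable_realfun.

Set Implicit Arguments.
Unset Strict Implicit.
Unset Printing Implicit Defensive.
Import Order.TTheory GRing.Theory Num.Theory.
Import numFieldNormedType.Exports.

Local Open Scope classical_set_scope.
Local Open Scope ring_scope.
Local Open Scope complex_scope.

Notation normc := (@ComplexField.Normc.normc _).

(* Complex Lebesgue spaces for a finite exponent.  MathComp-Analysis has only
   real-valued ones, without a norm. *)

Definition cmeasurable {d} {X : measurableType d} {R : realType}
    (f : X -> R[i]) : Prop :=
  measurable_fun setT (fun x => complex.Re (f x)) /\
  measurable_fun setT (fun x => complex.Im (f x)).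

Definition cLnorm {d} {X : measurableType d} {R : realType}
    (mu : {measure set X -> \bar R}) (p : R) (f : X -> R[i]) : \bar R :=
  Lnorm mu p%:E (fun x => (normc (f x))%:E).

Section cLfun.
Context d {X : measurableType d} {R : realType}.
Variable mu : {measure set X -> \bar R}.
Implicit Types f g : X -> R[i].

Lemma normcE_sqrt (z : R[i]) :
  normc z = Num.sqrt (complex.Re z ^+ 2 + complex.Im z ^+ 2).
Proof. by case: z. Qed.

Lemma normc_ge0 (z : R[i]) : 0 <= normc z.
Proof. by rewrite normcE_sqrt sqrtr_ge0. Qed.

Lemma measurable_normc f : cmeasurable f ->
  measurable_fun setT (fun x => normc (f x)).
Proof.
case=> mR mI; under eq_fun do rewrite normcE_sqrt.
apply: (@measurableT_comp _ _ _ _ _ _ (@Num.sqrt R)).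
  apply: continuous_measurable_fun; exact: sqrt_continuous.
by apply: measurable_funD; exact: measurable_funX.
Qed.

Lemma cLnorm_ge0 p f : (0 <= cLnorm mu p f)%E.
Proof. exact: Lnorm_ge0. Qed.

Lemma cmeasurableD f g : cmeasurable f -> cmeasurable g -> cmeasurable (f + g).
Proof.
move=> [fR fI] [gR gI]; split.
  rewrite (_ : (fun x => _) = (fun x => complex.Re (f x)) \+ (fun x => complex.Re (g x))).
    exact: measurable_funD.
  by apply/funext => x; rewrite /= fctE; case: (f x) (g x) => ? ? [].
rewrite (_ : (fun x => _) = (fun x => complex.Im (f x)) \+ (fun x => complex.Im (g x))).
  exact: measurable_funD.
by apply/funext => x; rewrite /= fctE; case: (f x) (g x) => ? ? [].
Qed.

Lemma cmeasurableZ (a : R[i]) f : cmeasurable f -> cmeasurable (a *: f).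
Proof.
move=> [fR fI]; case: a => a b; split.
  rewrite (_ : (fun x => _) =
    (fun x => a * complex.Re (f x)) \- (fun x => b * complex.Im (f x))).
    by apply: measurable_funB; exact: measurable_funM.
  by apply/funext => x; rewrite /= fctE; case: (f x).
rewrite (_ : (fun x => _) =
  (fun x => a * complex.Im (f x)) \+ (fun x => b * complex.Re (f x))).
  by apply: measurable_funD; exact: measurable_funM.
by apply/funext => x; rewrite /= fctE; case: (f x).
Qed.

Section finite_exponent.
Variables (p : R) (p1 : 1 <= p).

Lemma cLnormE f :
  cLnorm mu p f = ((\int[mu]_x (normc (f x) `^ p)%:E) `^ p^-1)%E.
Proof.
rewrite /cLnorm unlock; congr (_ `^ _)%E; apply: eq_integral => x _.
by rewrite /= ger0_norm ?normc_ge0.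
Qed.

Lemma measurable_normcX f : cmeasurable f ->
  measurable_fun setT (fun x => (normc (f x) `^ p)%:E).
Proof.
move=> mf; apply/measurable_EFinP.
apply: (@measurableT_comp _ _ _ _ _ _ (@powR R ^~ p)); first exact: measurable_powR.
exact: measurable_normc.
Qed.

Lemma cLnormD f g : cmeasurable f -> cmeasurable g ->
  (cLnorm mu p (f + g)%R <= cLnorm mu p f + cLnorm mu p g)%E.
Proof.
move=> mf mg; have mnf := measurable_normc mf; have mng := measurable_normc mg.
have p0 : 0 < p by rewrite (lt_le_trans ltr01).
have := @eminkowski _ _ _ mu _ _ p%:E mnf mng.
rewrite lee_fin => /(_ p1); apply: le_trans.
rewrite cLnormE (_ : Lnorm _ _ _ =
    ((\int[mu]_x (`|normc (f x) + normc (g x)| `^ p)%:E) `^ p^-1)%E); last first.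
  by rewrite unlock.
apply: gt0_ler_poweR.
- by rewrite invr_ge0 ltW.
- by rewrite in_itv/= leey andbT; apply: integral_ge0 => x _; rewrite lee_fin powR_ge0.
- by rewrite in_itv/= leey andbT; apply: integral_ge0 => x _; rewrite lee_fin powR_ge0.
apply: ge0_le_integral => //.
- by move=> x _; rewrite lee_fin powR_ge0.
- by apply: measurable_normcX; exact: cmeasurableD.
- apply/measurable_EFinP.
  apply: (@measurableT_comp _ _ _ _ _ _ (@powR R ^~ p)); first exact: measurable_powR.
  by apply: measurableT_comp => //; exact: measurable_funD.
move=> x _; rewrite lee_fin.
have nD : normc ((f + g) x) <= normc (f x) + normc (g x) by exact: (@le_normcD R).
rewrite [`|_ + _|]ger0_norm ?addr_ge0 ?normc_ge0//.
by apply: ge0_ler_powR; rewrite ?nnegrE ?addr_ge0 ?normc_ge0 ?(ltW p0).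
Qed.

Lemma cLnormZ (a : R[i]) f : cmeasurable f ->
  cLnorm mu p (a *: f) = ((normc a)%:E * cLnorm mu p f)%E.
Proof.
move=> mf; have p0 : p != 0 by rewrite gt_eqF// (lt_le_trans ltr01).
rewrite !cLnormE.
under eq_integral => x _.
  rewrite [normc _](_ : _ = normc a * normc (f x)); last first.
    exact: (ComplexField.Normc.normcM a (f x)).
  rewrite powRM ?normc_ge0// EFinM.
  over.
have int0 : (0 <= \int[mu]_x (normc (f x) `^ p)%:E)%E.
  by apply: integral_ge0 => x _; rewrite lee_fin powR_ge0.
rewrite ge0_integralZl//; last first.
- by rewrite lee_fin powR_ge0.
- by move=> x _; rewrite lee_fin powR_ge0.
- exact: measurable_normcX.
rewrite poweRM ?lee_fin ?powR_ge0//.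
by rewrite poweR_EFin -powRrM mulfV// powRr1 ?normc_ge0.
Qed.

Definition cLfun of 1 <= p : {pred X -> R[i]} :=
  fun f => `[< cmeasurable f /\ (cLnorm mu p f < +oo)%E >].

Lemma cLnorm0 : cLnorm mu p 0 = 0.
Proof.
rewrite /cLnorm (_ : (fun x => _) = cst 0).
  by rewrite Lnorm0// eqe gt_eqF// (lt_le_trans ltr01).
by apply/funext => x; rewrite [normc _]ComplexField.Normc.normc0.
Qed.

Lemma cLfun_submod_closed : submod_closed (cLfun p1).
Proof.
split.
  apply/asboolP; split; last by rewrite cLnorm0.
  by split; exact: measurable_cst.
move=> a f g /asboolP[mf fy] /asboolP[mg gy]; apply/asboolP; split.
  by apply: cmeasurableD => //; exact: cmeasurableZ.
apply: le_lt_trans (cLnormD (cmeasurableZ a mf) mg) _.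
rewrite lte_add_pinfty// cLnormZ// lte_mul_pinfty// ?lee_fin ?normc_ge0//.
Qed.

End finite_exponent.
End cLfun.

Section cLspace.
Context d {X : measurableType d} {R : realType}.
Variables (mu : {measure set X -> \bar R}) (p : R) (p1 : 1 <= p).

HB.instance Definition _ := GRing.isSubmodClosed.Build _ _ (cLfun mu p1)
  (cLfun_submod_closed mu p1).

Definition cLfunType : Type := {f : X -> R[i] | f \in cLfun mu p1}.

HB.instance Definition _ := SubType.on cLfunType.
HB.instance Definition _ := Choice.on cLfunType.
HB.instance Definition _ := [SubChoice_isSubLmodule of cLfunType by <:].

Lemma cLfunP (f : cLfunType) :
  cmeasurable (val f) /\ (cLnorm mu p (val f) < +oo)%E.
Proof. exact/asboolP/(valP f). Qed.

Definition cLnull : {pred cLfunType} :=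
  fun f => `[< {ae mu, forall x, val f x = 0} >].

Lemma cLnull_zmod_closed : zmod_closed cLnull.
Proof.
split; first by apply/asboolP; apply: nearW => x; rewrite GRing.val0.
move=> f g /asboolP f0 /asboolP g0; apply/asboolP.
apply: filterS2 f0 g0 => x f0 g0; rewrite GRing.valB.
by rewrite [LHS](_ : _ = val f x - val g x)// f0 g0 subrr.
Qed.

HB.instance Definition _ := GRing.isZmodClosed.Build _ cLnull cLnull_zmod_closed.

(* L^p proper: p-integrable functions modulo a.e. equality, a normed module over
   R[i].  cLclass f is the class of f, cLspace_fun F a representative of F. *)
Definition cLspace : Type := Quotient.quot (cLnull : zmodClosed cLfunType).

HB.instance Definition _ := EqQuotient.on cLspace.
HB.instance Definition _ := Choice.on cLspace.
HB.instance Definition _ := ZmodQuotient.on cLspace.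

Implicit Types (a b : R[i]) (f g : cLfunType) (F G : cLspace).
Local Open Scope quotient_scope.

Definition cLclass f : cLspace := \pi_cLspace f.

Definition cLspace_fun F : X -> R[i] := val (repr F).

Lemma cLspaceW (P : cLspace -> Prop) :
  (forall f, P (cLclass f)) -> forall F, P F.
Proof. by move=> Pf F; rewrite -[F]reprK; exact: Pf. Qed.

Lemma cLclassP f g :
  cLclass f = cLclass g <-> {ae mu, forall x, val f x = val g x}.
Proof.
have -> : (cLclass f = cLclass g) <-> {ae mu, forall x, val (f - g) x = 0}.
  split=> [/eqP|fg]; [|apply/eqP]; rewrite /cLclass -Quotient.idealrBE.
    by move/asboolP.
  exact/asboolP.
split; apply: filterS => x; rewrite GRing.valB => fg.
  by apply/eqP; rewrite -subr_eq0; apply/eqP; exact: fg.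
by rewrite [LHS](_ : _ = val f x - val g x)// fg subrr.
Qed.

Lemma cLclassK f : {ae mu, forall x, cLspace_fun (cLclass f) x = val f x}.
Proof. by apply/cLclassP; exact: reprK. Qed.

Lemma cLclassD f g : cLclass (f + g) = cLclass f + cLclass g.
Proof. exact: pi_addr. Qed.

Definition cLscale a F : cLspace := cLclass (a *: repr F).

Lemma cLscaleE a f : cLscale a (cLclass f) = cLclass (a *: f).
Proof.
apply/cLclassP; apply: filterS (cLclassK f) => x fx.
rewrite !GRing.valZ.
rewrite [LHS](_ : _ = a *: cLspace_fun (cLclass f) x)//.
by rewrite [RHS](_ : _ = a *: val f x)// fx.
Qed.

Lemma cLscaleA a b F : cLscale a (cLscale b F) = cLscale (a * b) F.
Proof.
elim/cLspaceW: F => f.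
by rewrite (cLscaleE b f) (cLscaleE a (b *: f)) (cLscaleE (a * b) f) scalerA.
Qed.

Lemma cLscale1 : left_id 1 cLscale.
Proof. by elim/cLspaceW => f; rewrite (cLscaleE 1 f) scale1r. Qed.

Lemma cLscaleDr : right_distributive cLscale +%R.
Proof.
move=> a; elim/cLspaceW => f; elim/cLspaceW => g.
rewrite -cLclassD (cLscaleE a f) (cLscaleE a g) (cLscaleE a (f + g)).
by rewrite scalerDr cLclassD.
Qed.

Lemma cLscaleDl F : {morph cLscale^~ F : a b / a + b}.
Proof.
move=> a b; elim/cLspaceW: F => f.
by rewrite (cLscaleE (a + b) f) (cLscaleE a f) (cLscaleE b f) scalerDl cLclassD.
Qed.

HB.instance Definition _ := GRing.Zmodule_isLmodule.Build R[i] cLspace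
  cLscaleA cLscale1 cLscaleDr cLscaleDl.

Lemma cLclassZ a f : cLclass (a *: f) = a *: cLclass f.
Proof. by rewrite -(cLscaleE a f). Qed.

Lemma cLnorm_ae f g : {ae mu, forall x, val f x = val g x} ->
  cLnorm mu p (val f) = cLnorm mu p (val g).
Proof.
move=> fg; rewrite !cLnormE; congr (_ `^ _)%E.
have [mf _] := cLfunP f; have [mg _] := cLfunP g.
apply: ae_eq_integral => //; try exact: measurable_normcX.
by apply: filterS fg => x -> _.
Qed.

Definition cLspace_norm F : R[i] :=
  (fine (cLnorm mu p (cLspace_fun F)))%:C.

Lemma cLspace_normE f : cLspace_norm (cLclass f) = (fine (cLnorm mu p (val f)))%:C.
Proof. by congr (fine _)%:C; apply: cLnorm_ae; exact: cLclassK. Qed.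

Lemma cLnorm_fin f : cLnorm mu p (val f) \is a fin_num.
Proof. by have [_ fy] := cLfunP f; rewrite ge0_fin_numE// cLnorm_ge0. Qed.

Lemma cLspace_normD F G :
  cLspace_norm (F + G) <= cLspace_norm F + cLspace_norm G.
Proof.
elim/cLspaceW: F => f; elim/cLspaceW: G => g.
rewrite -cLclassD !cLspace_normE -rmorphD/= lecR -fineD ?cLnorm_fin//.
have [mf _] := cLfunP f; have [mg _] := cLfunP g.
apply: fine_le; [exact: (cLnorm_fin (f + g))| |exact: cLnormD].
by rewrite fin_numD (cLnorm_fin f) (cLnorm_fin g).
Qed.

Lemma cLspace_normZ a F : cLspace_norm (a *: F) = `|a| * cLspace_norm F.
Proof.
elim/cLspaceW: F => f.
rewrite -cLclassZ !cLspace_normE GRing.valZ.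
have [mf _] := cLfunP f.
rewrite cLnormZ// fineM ?cLnorm_fin// rmorphM.
by congr (_ * _); rewrite normc_def normcE_sqrt.
Qed.

Lemma cLspace_norm0_eq0 F : cLspace_norm F = 0 -> F = 0.
Proof.
elim/cLspaceW: F => f; rewrite cLspace_normE => -[f0].
have [mf _] := cLfunP f.
rewrite -[RHS](_ : cLclass 0 = 0); last exact: pi_zeror.
apply/cLclassP; rewrite GRing.val0.
have : cLnorm mu p (val f) = 0%E by rewrite -(fineK (cLnorm_fin f)) f0.
move/Lnorm_eq0_eq0 => /(_ _ _)/=.
have mnf : measurable_fun setT (fun x => (normc (val f x))%:E).
  exact/measurable_EFinP/measurable_normc.
have p0 : (0 < p%:E)%E by rewrite lte_fin (lt_le_trans ltr01).
move=> /(_ mnf p0); apply: filterS => x /(_ I)[].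
exact: ComplexField.Normc.eq0_normc.
Qed.

HB.instance Definition _ := Lmodule_isNormed.Build R[i] cLspace
  cLspace_normD cLspace_normZ cLspace_norm0_eq0.

End cLspace.

Section nuclear.
Context {R : realType} {Y Z : normedModType R[i]}.

(* The norm of a normed module over R[i] has type R[i], although its values are
   real; rnorm is the same norm in R. *)
Definition rnorm (z : Z) : R := complex.Re `|z|.

Definition bounded_op (T : Y -> Z) : Prop :=
  exists M : R, forall y, `|T y| <= M%:C * `|y|.

Definition op_norm (T : Y -> Z) : R :=
  sup [set rnorm (T y) | y in [set y | `|y| <= 1]].

End nuclear.

Definition nuclear {R : realType} {Y Z : normedModType R[i]} (T : Y -> Z) :
    Prop :=
  exists (phi : nat -> {linear Y -> R[i]^o}) (z : nat -> Z),
    [/\ forall n, bounded_op (phi n),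
        (\sum_(n <oo) (op_norm (phi n) * rnorm (z n))%:E < +oo)%E &
        forall y, series (fun n => (phi n y : R[i]) *: z n) @ \oo --> T y].

Section conditional_expectation.
Context d {X : measurableType d} {R : realType}.
Variables (mu : {measure set X -> \bar R}) (A : set (set X)).

Definition is_cond_exp (f g : X -> \bar R) : Prop :=
  [/\ measurable_fun [set: g_sigma_algebraType A] g,
      forall x, (0 <= g x)%E &
      forall F, A F -> (\int[mu]_(x in F) g x = \int[mu]_(x in F) f x)%E].

(* A version of E(f), for a measurable f >= 0.  When A is a sub-sigma-algebra on
   which mu is sigma-finite, one exists and is unique up to null sets, so the
   default value is never used. *)
Definition cond_exp (f : X -> \bar R) : X -> \bar R :=
  xget (cst 0%E) [set g | is_cond_exp f g].

Definition conditionable (f : X -> R[i]) : Prop :=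
  cmeasurable f /\
  {ae mu, forall x, (cond_exp (fun y => (normc (f y))%:E) x < +oo)%E}.

(* The linear extension of E to real, then complex, conditionable functions. *)
Definition rcond_exp (h : X -> R) : X -> R :=
  fun x => fine (cond_exp (EFin \o h)^\+%E x) - fine (cond_exp (EFin \o h)^\-%E x).

Definition ccond_exp (f : X -> R[i]) : X -> R[i] :=
  fun x => rcond_exp (fun y => complex.Re (f y)) x +i*
           rcond_exp (fun y => complex.Im (f y)) x.

Definition atom (F : set X) : Prop :=
  [/\ A F, (0 < mu F)%E &
      forall G, A G -> G `<=` F -> mu G = 0%E \/ mu G = mu F].

Definition nonatomic (B : set X) : Prop :=
  forall F, F `<=` B -> ~ atom F.

(* h(F): the a.e. constant value on the atom F of an A-measurable h. *)
Definition atom_value (h : X -> \bar R) (F : set X) : \bar R :=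
  xget 0%E [set c | {ae mu, forall x, F x -> h x = c}].

(* T is the weighted conditional expectation operator M_w E M_u, including the
   requirement that u f be conditionable for every f in L^p. *)
Definition is_WCE (w u : X -> R[i]) (p q : R) (p1 : 1 <= p) (q1 : 1 <= q)
    (T : cLspace mu p1 -> cLspace mu q1) : Prop :=
  forall f : cLspace mu p1,
    conditionable (fun x => u x * cLspace_fun f x) /\
    {ae mu, forall x, cLspace_fun (T f) x =
                      w x * ccond_exp (fun y => u y * cLspace_fun f y) x}.

End conditional_expectation.

(* Main.v *)
Require Import Defs.
From HB Require Import structures.
From mathcomp Require Import all_boot all_order all_algebra.
From mathcomp Require Import complex.
From mathcomp Require Import all_classical all_reals all_analysis.
From mathcomp Require Import measurable_realfun ring lra.

(* Necessity.  Let C_1, ..., C_k be disjoint and let f_i in the unit ball of L^p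
   be supported in C_i.  If T = sum_n phi_n (.) z_n then
     sum_i |1_{C_i} T f_i|_q <= sum_n sum_i |phi_n f_i| |1_{C_i} z_n|_q,
   and testing phi_n on sum_i e_i |1_{C_i} z_n|_q f_i with unimodular e_i shows
   that the inner sum is at most |phi_n| |z_n|, because
   sum_i |1_{C_i} z_n|_q^p <= |z_n|_q^p for q <= p.  No duality for L^p is used.
   Take for f_i the normalised conj(u) |u|^(p'-2) 1_{C_i and |u| <= M}: on atoms,
   letting M grow, this bound is (ii); on a non-atomic set where E|u|^p' and
   E|w|^q are bounded below, it bounds sum_i mu(C_i)^(1/r) for all partitions,
   which is absurd since 1/r < 1 and the C_i can be made arbitrarily small.

   Sufficiency.  On an atom A_i the operator 1_{A_i} T has range spanned by
   w 1_{A_i}, and its norm is controlled by Hoelder's inequality; condition (ii)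
   sums these rank one operators, and (i) says that T f vanishes on B. *)

Set Implicit Arguments.
Unset Strict Implicit.
Unset Printing Implicit Defensive.
Import Order.TTheory GRing.Theory Num.Theory.
Import numFieldNormedType.Exports.

Local Open Scope classical_set_scope.
Local Open Scope ring_scope.
Local Open Scope complex_scope.

(** * Conditional expectation on a sub-sigma-algebra *)

(** Only finiteness is at stake, so constants are given away freely: most factors 2 below replace a
    limit or a sharper estimate. In the necessity part, atoms and non-atomic sets go through one
    estimate. Its hypothesis, that the integral over F of the truncated |u|^p' is at least a mu(F)
    for all F of [A] inside C, is a weak form of the statement that the conditional expectation of
    this weight is at least a on C. With normalised test functions the contribution of C is then of
    order a v^(-1/p) (int_C |w|^q)^(1/q), where v is the integral of the weight over C. On an atom,
    a is the mean of the weight, and 1 - 1/p = 1/p' produces the term of (ii); where all the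
    integrals are comparable to mu(C), what remains is mu(C)^(1/q - 1/p) = mu(C)^(1/r). The cut-off
    |u| <= M puts the test functions in L^p without any prior integrability of |u|^p'. In (ii) one
    factor may be infinite while another is 0, so atoms on which u or w vanishes are treated
    separately in the sufficiency part. *)

Section sub_sigma_algebra.
Context d (X : measurableType d) (R : realType).
Variables (mu : {measure set X -> \bar R}) (A : set (set X)).
Hypotheses (sA : sigma_algebra [set: X] A) (A_sub : A `<=` measurable).

Let Y := g_sigma_algebraType A.

Lemma measurable_subE (F : set Y) : measurable F = A F.
Proof. by have := measurable_g_measurableTypeE sA => /(congr1 (@^~ F)). Qed.

Lemma measurable_id_sub : measurable_fun [set: X] (idfun : X -> Y).
Proof. by move=> _ F; rewrite measurable_subE setTI => /A_sub. Qed.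

Lemma measurable_fun_sub d' (Z : measurableType d') (g : X -> Z) :
  measurable_fun [set: Y] g -> measurable_fun [set: X] g.
Proof.
move=> mg _ F mF; rewrite setTI; apply: A_sub.
by have := mg measurableT F mF; rewrite setTI measurable_subE.
Qed.

(** [mu] seen on the sets of [Y], so that the Radon-Nikodym theorem can be applied over the smaller
    sigma-algebra. *)
Definition sub_measure (F : set Y) : \bar R := mu F.

Let sub_measure0 : sub_measure set0 = 0%E.
Proof. exact: measure0. Qed.

Let sub_measure_ge0 F : (0 <= sub_measure F)%E.
Proof. exact: measure_ge0. Qed.

Let sub_measure_sigma_additive : semi_sigma_additive sub_measure.
Proof.
move=> F mF tF mUF; apply: measure_semi_sigma_additive => //.
  by move=> i; apply: A_sub; rewrite -measurable_subE.
by apply: A_sub; rewrite -measurable_subE.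
Qed.

HB.instance Definition _ := isMeasure.Build _ _ _ sub_measure
  sub_measure0 sub_measure_ge0 sub_measure_sigma_additive.

Hypothesis sf : sigma_finite [set: Y] mu.

HB.instance Definition _ := @Measure_isSigmaFinite.Build _ _ _ sub_measure sf.

(** Change of variables for the identity map from [X] to [Y], under which [sub_measure] is the image
    of [mu]. *)
Lemma integral_sub (g : X -> \bar R) (F : set X) :
  measurable_fun [set: Y] g -> (forall x, 0 <= g x)%E -> A F ->
  (\int[sub_measure]_(x in F) g x = \int[mu]_(x in F) g x)%E.
Proof.
move=> mg g0 AF.
have -> : sub_measure = pushforward mu (idfun : X -> Y) by [].
rewrite (ge0_integral_pushforward measurable_id_sub)//.
  by rewrite measurable_subE.
exact: measurable_funTS.
Qed.

Section integral_measure.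
Variable f : X -> \bar R.
Hypotheses (mf : measurable_fun setT f) (f0 : forall x, (0 <= f x)%E).
Hypothesis foo : (\int[mu]_x f x < +oo)%E.

Definition sub_integral (F : set Y) : \bar R := \int[mu]_(x in F) f x.

Let sub_integral0 : sub_integral set0 = 0%E.
Proof. exact: integral_set0. Qed.

Let sub_integral_ge0 F : (0 <= sub_integral F)%E.
Proof. exact: integral_ge0. Qed.

Let sub_integral_sigma_additive : semi_sigma_additive sub_integral.
Proof.
move=> F mF tF _; have mF' i : measurable (F i : set X).
  by apply: A_sub; rewrite -measurable_subE.
rewrite /sub_integral ge0_integral_bigcup//; last exact: measurable_funTS.
by apply: is_cvg_nneseries => n _ _; exact: integral_ge0.
Qed.

HB.instance Definition _ := isMeasure.Build _ _ _ sub_integral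
  sub_integral0 sub_integral_ge0 sub_integral_sigma_additive.

Let sub_integral_fin : fin_num_fun sub_integral.
Proof.
move=> F; rewrite measurable_subE => AF.
rewrite ge0_fin_numE ?integral_ge0//; apply: le_lt_trans foo.
by apply: ge0_subset_integral => //; exact: A_sub.
Qed.

HB.instance Definition _ := Measure_isFinite.Build _ _ _ sub_integral
  sub_integral_fin.

(** The version is the Radon-Nikodym derivative of the finite measure [sub_integral] with respect to
    [sub_measure]. *)
Lemma cond_exp_exists_fin : exists g, is_cond_exp mu A f g.
Proof.
have [|g [g0 _ ig gE]] := @radon_nikodym_sigma_finite _ _ _ sub_measure sub_integral.
  apply/null_content_dominatesP => F; rewrite measurable_subE => AF F0.
  by apply: null_set_integral => //; [exact: A_sub|exact: measurable_funTS].
have mg : measurable_fun [set: Y] g by case/integrableP: ig.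
exists g; split => // F AF; rewrite -integral_sub//.
by rewrite -gE ?measurable_subE.
Qed.

End integral_measure.

(** As [f] takes finite values, [X] is a countable disjoint union of measurable sets of finite
    measure on which [f] is bounded, and the versions for the pieces of [f] add up. These sets need
    not belong to [A]: it is [f] that is cut, not its conditional expectation. *)
Lemma cond_exp_exists (f : X -> \bar R) :
    measurable_fun setT f -> (forall x, 0 <= f x < +oo)%E ->
  exists g, is_cond_exp mu A f g.
Proof.
move=> mf f0oo; have f0 x : (0 <= f x)%E by case/andP: (f0oo x).
have [F FT /all_and2[mF' Foo]] := sf.
have mF i : measurable (F i : set X) by apply: A_sub; rewrite -measurable_subE.
pose G n : set X := (\big[setU/set0]_(i < n) F i) `&` [set x | (f x <= n%:R%:E)%E].
have mfn n : measurable [set x | (f x <= n%:R%:E)%E].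
  by rewrite -[X in measurable X]setTI; exact: emeasurable_fun_infty_c.
have mG n : measurable (G n) by apply: measurableI => //; exact: bigsetU_measurable.
pose E := seqDU G.
have mE n : measurable (E n) by apply: measurableD => //; exact: bigsetU_measurable.
have mfE n : measurable_fun setT (f \_ (E n)).
  by apply/(measurable_restrictT _ (mE n)); exact: measurable_funTS.
have fE0 n x : (0 <= (f \_ (E n)) x)%E by rewrite patchE; case: ifPn.
have UE : \bigcup_n E n = setT.
  rewrite -seqDU_bigcup_eq; apply/seteqP; split => // x _.
  have : [set: X] x by [].
  rewrite FT => -[i _ Fix].
  pose m := maxn i.+1 (Num.truncn (fine (f x))).+1.
  exists m => //; split.
    by rewrite -bigcup_mkord; exists i => //=; rewrite leq_max ltnSn.
  rewrite /= -[f x]fineK ?lee_fin; last by rewrite ge0_fin_numE//; case/andP: (f0oo x).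
  apply: ltW; apply: lt_le_trans (archimedean.Num.Theory.truncnS_gt _) _.
  by rewrite ler_nat leq_max leqnn orbT.
have fin n : (\int[mu]_x (f \_ (E n)) x < +oo)%E.
  rewrite -integral_mkcond.
  apply: (@le_lt_trans _ _ (\int[mu]_(x in E n) cst n%:R%:E x)%E).
    apply: ge0_le_integral => //; first exact: measurable_funTS.
    by move=> x [[]].
  rewrite integral_cst// lte_mul_pinfty ?lee_fin//.
  apply: (@le_lt_trans _ _ (mu (\big[setU/set0]_(i < n) F i))).
    apply: le_measure; rewrite ?inE//; first exact: bigsetU_measurable.
    by move=> x [[]].
  apply: le_lt_trans (Boole_inequality mu _) _; first by move=> i _; exact: mF.
  by apply: lte_sum_pinfty => i _; exact: Foo.
have /choice[g gP] n := cond_exp_exists_fin (mfE n) (fE0 n) (fin n).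
exists (fun x => \sum_(n <oo) g n x)%E; split.
- by apply: (@ge0_emeasurable_sum _ Y _ _ _ predT) => [n x _ _|n _]; case: (gP n).
- move=> x; apply: nneseries_ge0 => n _ _; exact: (let: And3 _ h _ := gP n in h x).
move=> D AD; have mD := A_sub AD.
rewrite integral_nneseries//; last 2 first.
- move=> n; apply: measurable_funTS; apply: measurable_fun_sub.
  by case: (gP n).
- by move=> n x _; case: (gP n).
under eq_eseriesr do rewrite (let: And3 _ _ h := gP _ in h D AD).
rewrite -[in RHS](setIT D) -UE setI_bigcupr ge0_integral_bigcup//=; last 3 first.
- by move=> n; exact: measurableI.
- exact: measurable_funTS.
- exact/trivIset_setIl/trivIset_seqDU.
by under eq_eseriesr do rewrite -integral_mkcondr.
Qed.

End sub_sigma_algebra.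

Section ae_lemmas.
Context d (X : measurableType d) (R : realType).
Variable mu : {measure set X -> \bar R}.

Lemma ge0_integral_eq0 (D : set X) (f : X -> \bar R) : measurable D ->
    measurable_fun D f -> (forall x, (0 <= f x)%E) ->
  (\int[mu]_(x in D) f x = 0)%E <-> {ae mu, forall x, D x -> f x = 0%E}.
Proof.
move=> mD mf f0; have := ae_eq_integral_abs mu mD mf.
by under eq_integral => x _ do rewrite gee0_abs//.
Qed.

Lemma ae_notin (D : set X) : measurable D ->
  {ae mu, forall x, ~ D x} <-> mu D = 0%E.
Proof.
move=> mD; rewrite -(negligibleP mu mD); split => [|[N [mN N0 DN]]].
  by apply: negligibleS => x Dx /=; exact.
by exists N; split => // x /contrapT; exact: DN.
Qed.

Lemma lee_add_invn (x : \bar R) (r : R) :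
  (forall n, (x <= (r + n.+1%:R^-1)%:E)%E) -> (x <= r%:E)%E.
Proof.
move=> h; apply/lee_addgt0Pr => e e0; apply: le_trans (h (Num.truncn e^-1)) _.
rewrite -EFinD lee_fin lerD2l -[leRHS]invrK lef_pV2 ?posrE ?invr_gt0//.
exact/ltW/archimedean.Num.Theory.truncnS_gt.
Qed.

End ae_lemmas.

(** * Conditional expectations and atoms *)

Section cond_exp_theory.
Context d (X : measurableType d) (R : realType).
Variables (mu : {measure set X -> \bar R}) (A : set (set X)).
Hypotheses (sA : sigma_algebra [set: X] A) (A_sub : A `<=` measurable).
Hypothesis sf : sigma_finite [set: g_sigma_algebraType A] mu.
Let Y := g_sigma_algebraType A.
Implicit Types (f g h : X -> \bar R) (C D F G : set X).

Let AI F G : A F -> A G -> A (F `&` G).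
Proof. by rewrite -!(measurable_subE sA) => ? ?; exact: measurableI. Qed.

Let AD F G : A F -> A G -> A (F `\` G).
Proof. by rewrite -!(measurable_subE sA) => ? ?; exact: measurableD. Qed.

Lemma is_cond_expP f : measurable_fun setT f -> (forall x, 0 <= f x < +oo)%E ->
  is_cond_exp mu A f (cond_exp mu A f).
Proof. by move=> mf f0; apply: xgetPex; exact: cond_exp_exists. Qed.

(** The equality holds everywhere and not just almost everywhere: [f] and [g] have the same set of
    versions, from which [xget] makes the same choice. *)
Lemma eq_cond_exp f g : measurable_fun setT f -> measurable_fun setT g ->
  {ae mu, forall x, f x = g x} -> cond_exp mu A f = cond_exp mu A g.
Proof.
move=> mf mg fg; congr (xget _ _); apply/seteqP.
have E F : A F -> (\int[mu]_(x in F) f x = \int[mu]_(x in F) g x)%E.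
  move=> AF; apply: ae_eq_integral; [exact: A_sub|exact: measurable_funTS..|].
  by apply: filterS fg.
by split => h /= [mh h0 hE]; split => // F AF; rewrite hE// E.
Qed.

Section cond_exp_nonneg.
Variable f : X -> \bar R.
Hypotheses (mf : measurable_fun setT f) (f0 : (forall x, 0 <= f x < +oo)%E).

Lemma cond_exp_ge0 x : (0 <= cond_exp mu A f x)%E.
Proof. by case: (is_cond_expP mf f0) => _ + _; exact. Qed.

Lemma measurable_cond_exp_sub : measurable_fun [set: Y] (cond_exp mu A f).
Proof. by case: (is_cond_expP mf f0). Qed.

Lemma measurable_cond_exp : measurable_fun setT (cond_exp mu A f).
Proof. exact (measurable_fun_sub sA A_sub measurable_cond_exp_sub). Qed.

Lemma integral_cond_exp F : A F ->
  (\int[mu]_(x in F) cond_exp mu A f x = \int[mu]_(x in F) f x)%E.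
Proof. by case: (is_cond_expP mf f0) => _ _; exact. Qed.

(** Both sides say that the common integral of the two functions over [D] is 0. *)
Lemma cond_exp_eq0 D : A D ->
  {ae mu, forall x, D x -> f x = 0%E} <->
  {ae mu, forall x, D x -> cond_exp mu A f x = 0%E}.
Proof.
move=> AD'; have mD := A_sub AD'.
rewrite -!ge0_integral_eq0 ?integral_cond_exp//.
- by apply: measurable_funTS; exact: measurable_cond_exp.
- exact: cond_exp_ge0.
- exact: measurable_funTS.
- by move=> x; case/andP: (f0 x).
Qed.

(** On the set D where the conclusion fails, a mu(D) <= int_D f = int_D E(f) <= (a/2) mu(D), so D is
    null. Halving [a] gives this at once, without a limit over thresholds below [a]. *)
Lemma cond_exp_ge (a : R) C : 0 <= a -> A C -> (mu C < +oo)%E ->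
    (forall F, A F -> F `<=` C -> a%:E * mu F <= \int[mu]_(x in F) f x)%E ->
  {ae mu, forall x, C x -> ((a / 2)%:E <= cond_exp mu A f x)%E}.
Proof.
move=> a0 AC Coo CF.
move: a0; rewrite le_eqVlt => /predU1P[<-|a0].
  by rewrite mul0r; apply: nearW => x _; exact: cond_exp_ge0.
pose D := C `&` [set x | (cond_exp mu A f x < (a / 2)%:E)%E].
have AD' : A D.
  apply: AI => //; rewrite -(measurable_subE sA) -[X in measurable X]setTI.
  by apply: emeasurable_fun_infty_o => //; exact: measurable_cond_exp_sub.
have mD := A_sub AD'; have DC : D `<=` C by exact: subIsetl.
have Doo : (mu D < +oo)%E.
  by apply: le_lt_trans Coo; rewrite le_measure ?inE//; exact: A_sub.
suff /ae_notin : mu D = 0%E.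
  move=> /(_ mD); apply: filterS => x Dx Cx; rewrite leNgt; apply/negP => ?.
  by apply: Dx.
have : (a%:E * mu D <= (a / 2)%:E * mu D)%E.
  rewrite (le_trans (CF _ AD' DC))// -integral_cond_exp// -integral_cst//.
  apply: ge0_le_integral => //.
  - by move=> x _; exact: cond_exp_ge0.
  - by apply: measurable_funTS; exact: measurable_cond_exp.
  - by move=> x [_ /ltW].
have : (0 <= mu D)%E by [].
case: (mu D) Doo => [m _| |]//; rewrite -!EFinM !lee_fin => m0 am.
congr _%:E; nra.
Qed.

End cond_exp_nonneg.

Section atoms.
Variable F : set X.
Hypothesis aF : atom mu A F.

Let AF : A F. Proof. by case: aF. Qed.
Let mF : measurable F. Proof. exact: A_sub. Qed.

(** Cut by a countable cover of sets of finite measure, an atom has pieces of measure 0 or mu(F),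
    and they cannot all be null. *)
Lemma atom_ltey : (mu F < +oo)%E.
Proof.
case: aF => _ F0 Fat; have [G GT /all_and2[mG Goo]] := sf.
have AG i : A (G i) by rewrite -(measurable_subE sA).
have [[i FGi]|FG0] := pselect (exists i, mu (F `&` G i) = mu F).
  rewrite -FGi; apply: le_lt_trans (Goo i).
  by rewrite le_measure ?inE//; [apply: A_sub; exact: AI|exact: A_sub].
have FG i : mu (F `&` G i) = 0%E.
  have [//|h] := Fat _ (AI AF (AG i)) (@subIsetl _ _ _).
  by case: FG0; exists i.
suff : mu F = 0%E by move=> F00; rewrite F00 ltxx in F0.
have FE : F = \bigcup_i (F `&` G i) by rewrite -setI_bigcupr -GT setIT.
apply/(negligibleP mu mF); rewrite FE; apply: negligible_bigcup => i.
by apply/negligibleP; [exact/A_sub/AI|exact: FG].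
Qed.

Lemma fine_atom_gt0 : 0 < fine (mu F).
Proof. by apply: fine_gt0; rewrite atom_ltey andbT; case: aF. Qed.

Lemma fine_atomK : (fine (mu F))%:E = mu F.
Proof. by rewrite fineK// ge0_fin_numE// atom_ltey. Qed.

Lemma atom_dichotomy G : A G ->
  {ae mu, forall x, F x -> ~ G x} \/ {ae mu, forall x, F x -> G x}.
Proof.
move=> AG; case: aF => _ _ /(_ _ (AI AF AG) (@subIsetl _ _ _))[FG|FG]; [left|right].
  have /ae_notin-/(_ (A_sub (AI AF AG))) := FG.
  by apply: filterS => x FGx Fx Gx; exact: FGx.
have : mu (F `\` G) = 0%E.
  rewrite (measureD mF (A_sub AG) atom_ltey).
  by rewrite [X in (_ - X)%E]FG subee// ge0_fin_numE// atom_ltey.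
move/ae_notin => /(_ (A_sub (AD AF AG))); apply: filterS => x FGx Fx.
by apply: contrapT => nGx; exact: FGx.
Qed.

Section atom_constant.
Variable h : X -> \bar R.
Hypotheses (mh : measurable_fun [set: Y] h) (h0 : forall x, (0 <= h x)%E).
Let c := (\int[mu]_(x in F) h x * ((fine (mu F))^-1)%:E)%E.

Let mhX : measurable_fun F h.
Proof. by apply: measurable_funTS; exact (measurable_fun_sub sA A_sub mh). Qed.

Let le_c (t : R) : (t%:E <= c)%E = (t%:E * mu F <= \int[mu]_(x in F) h x)%E.
Proof. by rewrite lee_pdivlMr ?fine_atom_gt0// fine_atomK. Qed.

Let ge_c (t : R) : (c <= t%:E)%E = (\int[mu]_(x in F) h x <= t%:E * mu F)%E.
Proof. by rewrite lee_pdivrMr ?fine_atom_gt0// fine_atomK. Qed.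

(** If h > t held almost everywhere on [F], the mean [c] of [h] over [F] would be at least t. By the
    dichotomy for atoms, h <= t then holds almost everywhere on [F]. *)
Let le_t (t : R) : (c < t%:E)%E -> {ae mu, forall x, F x -> (h x <= t%:E)%E}.
Proof.
move=> ct; have t0 : 0 <= t.
  by rewrite -lee_fin (le_trans _ (ltW ct))// mule_ge0 ?lee_fin
    ?invr_ge0 ?integral_ge0// ltW// fine_atom_gt0.
have AG : A [set x | (t%:E < h x)%E].
  rewrite -(measurable_subE sA) -[X in measurable X]setTI.
  exact: emeasurable_fun_o_infty.
have [|Gt] := atom_dichotomy AG.
  by apply: filterS => x /[apply]/negP; rewrite -leNgt.
exfalso; move: ct; rewrite ltNge le_c => /negP; apply.
rewrite -integral_cst//; apply: ae_ge0_le_integral => //.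
by apply: filterS Gt => x /[apply] /ltW.
Qed.

Let ge_t (t : R) : (t%:E < c)%E -> {ae mu, forall x, F x -> (t%:E <= h x)%E}.
Proof.
move=> ct; have [t0|t0] := leP 0 t; last first.
  by apply: nearW => x _; rewrite (le_trans _ (h0 x))// lee_fin ltW.
have AG : A [set x | (h x < t%:E)%E].
  rewrite -(measurable_subE sA) -[X in measurable X]setTI.
  exact: emeasurable_fun_infty_o.
have [|Gt] := atom_dichotomy AG.
  by apply: filterS => x /[apply]/negP; rewrite -leNgt.
exfalso; move: ct; rewrite ltNge ge_c => /negP; apply.
rewrite -integral_cst//; apply: ae_ge0_le_integral => //.
by apply: filterS Gt => x /[apply] /ltW.
Qed.

(** Countably many of the bounds [le_t] and [ge_t] hold simultaneously almost everywhere: at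
    distance 1/(n+1) from a finite mean, or at the levels n when the mean is infinite. *)
Lemma atom_constant : {ae mu, forall x, F x -> h x = c}.
Proof.
have : (0 <= c)%E.
  by rewrite mule_ge0 ?lee_fin ?invr_ge0 ?integral_ge0// ltW// fine_atom_gt0.
move: le_t ge_t; case: c => [r| |]// leT geT _; last first.
  have : {ae mu, forall x, forall n, F x -> (n%:R%:E <= h x)%E}.
    by apply: ae_foralln => n; apply: geT; rewrite ltry.
  apply: filterS => x hx Fx; apply/eqyP => t _.
  apply: le_trans (hx (Num.truncn t).+1 Fx).
  exact/ltW/archimedean.Num.Theory.truncnS_gt.
have : {ae mu, forall x, forall n, F x -> (h x <= (r + n.+1%:R^-1)%:E)%E}.
  by apply: ae_foralln => n; apply: leT; rewrite lte_fin ltrDl.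
have : {ae mu, forall x, forall n, F x -> ((r - n.+1%:R^-1)%:E <= h x)%E}.
  by apply: ae_foralln => n; apply: geT; rewrite lte_fin ltrBlDr ltrDl.
apply: filterS2 => x hx1 hx2 Fx; apply/eqP; rewrite eq_le; apply/andP; split.
  by apply: lee_add_invn => n; exact: hx2.
have := @lee_add_invn R (- h x)%E (- r); rewrite EFinN leeN2; apply => n.
by rewrite leeNl -EFinN opprD opprK; exact: hx1.
Qed.

(** The constant chosen by [xget] is unique because [F] is not null. *)
Lemma atom_valueE : atom_value mu h F = c.
Proof.
have : {ae mu, forall x, F x -> h x = atom_value mu h F}.
  apply: (@xgetPex _ 0%E [set c | {ae mu, forall x, F x -> h x = c}]).
  by exists c; exact: atom_constant.
move=> hF; apply: contrapT => nc.
have : {ae mu, forall x, ~ F x}.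
  by apply: filterS2 hF atom_constant => x h1 h2 Fx; apply: nc; rewrite -h1// -h2.
by move/ae_notin => /(_ mF) F0; have := fine_atom_gt0; rewrite F0 ltxx.
Qed.

End atom_constant.
End atoms.
End cond_exp_theory.

(** * Restriction operators on complex Lebesgue spaces *)

Lemma normc_real {R : realType} (x : R) : 0 <= x -> normc x%:C = x.
Proof. by move=> x0; rewrite normcE_sqrt/= expr0n/= addr0 sqrtr_sqr ger0_norm. Qed.

Lemma normc_normr {R : realType} (z : R[i]) : `|z| = (normc z)%:C.
Proof. by rewrite normc_def normcE_sqrt. Qed.

Lemma powR_le_inj {R : realType} (p a b : R) : 0 < p -> 0 <= a -> 0 <= b ->
  a `^ p <= b `^ p -> a <= b.
Proof.
move=> p0 a0 b0; apply: contraTT; rewrite -!ltNge => ba.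
by apply: gt0_ltr_powR; rewrite ?nnegrE.
Qed.

Section rnorm_theory.
Context {R : realType} {Z : normedModType R[i]}.
Implicit Types (a : R[i]) (x y z : Z).

Lemma normr_rnorm z : `|z| = (rnorm z)%:C.
Proof. by rewrite /rnorm RRe_real// ger0_real. Qed.

Lemma rnorm_ge0 z : 0 <= rnorm z.
Proof. by rewrite -ler0c -normr_rnorm. Qed.

Lemma rnormD x y : rnorm (x + y) <= rnorm x + rnorm y.
Proof. by rewrite -lecR rmorphD/= -!normr_rnorm ler_normD. Qed.

Lemma rnormZ a z : rnorm (a *: z) = normc a * rnorm z.
Proof.
by apply: complexI; rewrite rmorphM/= -!normr_rnorm normrZ normc_normr.
Qed.

Lemma rnorm0 : rnorm (0 : Z) = 0.
Proof. by rewrite /rnorm normr0. Qed.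

Lemma rnorm_sum n (z : nat -> Z) : rnorm (\sum_(i < n) z i) <= \sum_(i < n) rnorm (z i).
Proof.
elim/big_ind2 : _ => //; first by rewrite rnorm0.
by move=> x r y s xr ys; apply: le_trans (rnormD _ _) _; exact: lerD.
Qed.

End rnorm_theory.

Lemma op_norm_has_ubound {R : realType} {Y Z : normedModType R[i]} (T : Y -> Z) :
  bounded_op T -> has_ubound [set rnorm (T y) | y in [set y | `|y| <= 1]].
Proof.
move=> [M TM]; exists `|M| => _ [z /= z1 <-].
apply: (@le_trans _ _ (M * rnorm z)).
  by rewrite -lecR rmorphM/= -!normr_rnorm.
move: z1; rewrite normr_rnorm -[1]/(1%:C) lecR => z1.
apply: le_trans (ler_norm _) _; rewrite normrM.
by rewrite ler_piMr// ger0_norm ?rnorm_ge0.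
Qed.

Lemma op_norm_ge0 {R : realType} {Y Z : normedModType R[i]} (T : Y -> Z) :
  bounded_op T -> 0 <= op_norm T.
Proof.
move=> bT; apply: (@le_trans _ _ (rnorm (T 0))); first exact: rnorm_ge0.
apply: ub_le_sup; first exact: op_norm_has_ubound.
by exists 0 => //=; rewrite normr0.
Qed.

Lemma op_norm_bound {R : realType} {Y Z : normedModType R[i]} (T : {linear Y -> Z}) :
  bounded_op T -> forall y, rnorm (T y) <= op_norm T * rnorm y.
Proof.
move=> bT y; have [y0|] := eqVneq (rnorm y) 0.
  have -> : y = 0 by apply: normr0_eq0; rewrite normr_rnorm y0.
  by rewrite linear0 !rnorm0 mulr0.
rewrite neq_lt ltNge rnorm_ge0/= => y0.
rewrite -ler_pdivrMr//; apply: ub_le_sup; first exact: op_norm_has_ubound.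
exists ((rnorm y)^-1%:C *: y).
  rewrite /= normr_rnorm rnormZ normc_real ?invr_ge0 ?(ltW y0)//.
  by rewrite mulVf// gt_eqF.
by rewrite linearZ rnormZ normc_real ?invr_ge0 ?(ltW y0)// mulrC.
Qed.

Lemma op_norm_le {R : realType} {Y Z : normedModType R[i]} (T : {linear Y -> Z}) (M : R) :
  0 <= M -> (forall y, rnorm (T y) <= M * rnorm y) -> op_norm T <= M.
Proof.
move=> M0 TM; apply: ge_sup.
  by exists (rnorm (T 0)); exists 0 => //=; rewrite normr0.
move=> _ [z /= z1 <-]; apply: le_trans (TM z) _.
move: z1; rewrite normr_rnorm -[1]/(1%:C) lecR => z1.
by rewrite ler_piMr.
Qed.

Section restriction.
Context d {X : measurableType d} {R : realType}.
Variables (mu : {measure set X -> \bar R}) (p : R) (p1 : 1 <= p).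
Implicit Types (f g : X -> R[i]) (C : set X) (F G : cLspace mu p1).

Let p0 : 0 < p. Proof. exact: lt_le_trans ltr01 p1. Qed.

Lemma cLnorm_ltey f :
  (cLnorm mu p f < +oo)%E = (\int[mu]_x (normc (f x) `^ p)%:E < +oo)%E.
Proof.
rewrite cLnormE; apply/idP/idP => [|h]; last exact: poweR_lty.
by apply: lty_poweRy; rewrite invr_neq0// gt_eqF.
Qed.

Lemma cLfun_integral_ltey (f : cLfunType mu p1) :
  (\int[mu]_x (normc (val f x) `^ p)%:E < +oo)%E.
Proof. by rewrite -cLnorm_ltey; have [] := cLfunP f. Qed.

Definition mk_cLfun f (mf : cmeasurable f)
    (foo : (\int[mu]_x (normc (f x) `^ p)%:E < +oo)%E) : cLfunType mu p1 :=
  exist _ f (introT (asboolP _) (conj mf (etrans (cLnorm_ltey f) foo))).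

Lemma rnorm_cLclass (f : cLfunType mu p1) :
  ((rnorm (cLclass f)) `^ p)%:E = (\int[mu]_x (normc (val f x) `^ p)%:E)%E.
Proof.
rewrite /rnorm [`|_|]cLspace_normE/= -poweR_EFin fineK ?cLnorm_fin//.
rewrite cLnormE -poweRrM mulVf ?gt_eqF// poweRe1//.
by apply: integral_ge0 => x _; rewrite lee_fin powR_ge0.
Qed.

Lemma cLspace_ext F G :
  {ae mu, forall x, cLspace_fun F x = cLspace_fun G x} -> F = G.
Proof.
move=> FG; rewrite -[F]reprK -[G]reprK.
exact: (@cLclassP _ _ _ mu p p1 (repr F) (repr G)).2.
Qed.

Lemma rnorm_cLspace F :
  ((rnorm F) `^ p)%:E = (\int[mu]_x (normc (cLspace_fun F x) `^ p)%:E)%E.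
Proof. by rewrite -{1}[F]reprK rnorm_cLclass. Qed.

Lemma cmeasurable_cLspace F : cmeasurable (cLspace_fun F).
Proof. by have [] := cLfunP (repr F). Qed.

Lemma cLspace_funD F G : {ae mu, forall x,
  cLspace_fun (F + G) x = cLspace_fun F x + cLspace_fun G x}.
Proof.
have e : cLclass (repr F + repr G) = F + G.
  by rewrite cLclassD -[F in RHS]reprK -[G in RHS]reprK.
have := cLclassK (repr F + repr G); apply: filterS => x.
by rewrite e.
Qed.

Lemma cLspace_funZ a F : {ae mu, forall x,
  cLspace_fun (a *: F) x = a * cLspace_fun F x}.
Proof.
have e : cLclass (a *: repr F) = a *: F by rewrite cLclassZ -[F in RHS]reprK.
have := cLclassK (a *: repr F); apply: filterS => x.
by rewrite e.
Qed.

Definition cut C f : X -> R[i] := fun x => if x \in C then f x else 0.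

Lemma cmeasurable_cut C f : measurable C -> cmeasurable f -> cmeasurable (cut C f).
Proof.
move=> mC [fR fI]; split.
  rewrite (_ : (fun x => _) = (fun x => \1_C x * complex.Re (f x))).
    by apply: measurable_funM => //; exact: measurable_indic.
  by apply/funext => x; rewrite /cut indicE; case: ifPn; rewrite ?mul1r ?mul0r.
rewrite (_ : (fun x => _) = (fun x => \1_C x * complex.Im (f x))).
  by apply: measurable_funM => //; exact: measurable_indic.
by apply/funext => x; rewrite /cut indicE; case: ifPn; rewrite ?mul1r ?mul0r.
Qed.

Lemma integral_cut C f :
  (\int[mu]_x (normc (cut C f x) `^ p)%:E = \int[mu]_(x in C) (normc (f x) `^ p)%:E)%E.
Proof.
rewrite [RHS]integral_mkcond; apply: eq_integral => x _; rewrite patchE /cut.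
by case: ifPn => // _; rewrite ComplexField.Normc.normc0 powR0// gt_eqF.
Qed.

Lemma integral_cut_ltey C f : measurable C -> cmeasurable f ->
  (\int[mu]_x (normc (f x) `^ p)%:E < +oo)%E ->
  (\int[mu]_x (normc (cut C f x) `^ p)%:E < +oo)%E.
Proof.
move=> mC mf; apply: le_lt_trans; rewrite integral_cut.
apply: ge0_subset_integral => //; first exact: measurable_normcX.
by move=> x _; rewrite lee_fin powR_ge0.
Qed.

Section restr.
Variables (C : set X) (mC : measurable C).

(** The operator 1_C of the overview: multiplication by the indicator of [C], acting on classes. *)
Definition restr F : cLspace mu p1 :=
  cLclass (mk_cLfun (cmeasurable_cut mC (cmeasurable_cLspace F))
    (integral_cut_ltey mC (cmeasurable_cLspace F) (cLfun_integral_ltey (repr F)))).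

Lemma restr_fun F : {ae mu, forall x, cLspace_fun (restr F) x = cut C (cLspace_fun F) x}.
Proof. exact: cLclassK. Qed.

Lemma rnorm_restr F :
  ((rnorm (restr F)) `^ p)%:E = (\int[mu]_(x in C) (normc (cLspace_fun F x) `^ p)%:E)%E.
Proof. by rewrite rnorm_cLclass; exact: integral_cut. Qed.

Lemma restr_is_linear : linear restr.
Proof.
move=> a F G; apply: cLspace_ext.
apply: filter_app (cLspace_funD (a *: restr F) (restr G)).
apply: filter_app (cLspace_funZ a (restr F)); apply: filter_app (restr_fun F).
apply: filter_app (restr_fun G); apply: filter_app (restr_fun (a *: F + G)).
apply: filter_app (cLspace_funD (a *: F) G); apply: filter_app (cLspace_funZ a F).
apply: aeW => x eZ eD e eG eF eZ' eD'; apply: (etrans e).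
apply: etrans _ (esym (etrans eD' (congr2 +%R (etrans eZ' (congr1 ( *%R a) eF)) eG))).
rewrite /cut; case: ifPn => _; last by rewrite mulr0 addr0.
by rewrite eD eZ.
Qed.

HB.instance Definition _ := GRing.isLinear.Build _ _ _ _ restr restr_is_linear.

Lemma rnorm_restr_le F : rnorm (restr F) <= rnorm F.
Proof.
apply: (@powR_le_inj _ p); rewrite ?rnorm_ge0// -lee_fin rnorm_restr rnorm_cLspace.
apply: ge0_subset_integral => //.
  by apply: measurable_normcX; exact: cmeasurable_cLspace.
by move=> x _; rewrite lee_fin powR_ge0.
Qed.

End restr.

End restriction.

(** * The nuclear norm and functions with disjoint supports *)

Lemma rnorm_regular {R : realType} (c : R[i]^o) : rnorm c = normc (c : R[i]).
Proof. by rewrite /rnorm [X in complex.Re X]normc_normr. Qed.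

Section sum_restr.
Context d {X : measurableType d} {R : realType}.
Variables (mu : {measure set X -> \bar R}) (p : R) (p1 : 1 <= p).
Variables (k : nat) (C : nat -> set X).
Hypotheses (mC : forall i, measurable (C i)) (tC : trivIset setT C).

Lemma sum_rnorm_restr (F : cLspace mu p1) :
  \sum_(i < k) rnorm (restr (mC i) F) `^ p <= rnorm F `^ p.
Proof.
rewrite -lee_fin -sumEFin rnorm_cLspace.
under eq_bigr do rewrite rnorm_restr.
have mF : measurable_fun setT (fun x => (normc (cLspace_fun F x) `^ p)%:E).
  by apply: measurable_normcX; exact: cmeasurable_cLspace.
rewrite -(big_mkord xpredT (fun i => \int[mu]_(x in C i) (normc (cLspace_fun F x) `^ p)%:E)%E).
rewrite -ge0_integral_bigsetU//.
- apply: ge0_subset_integral => //; first exact: bigsetU_measurable.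
  by move=> x _; rewrite lee_fin powR_ge0.
- exact: iota_uniq.
- exact: sub_trivIset tC.
- exact: measurable_funTS.
- by move=> x _; rewrite lee_fin powR_ge0.
Qed.

End sum_restr.

Section disjoint_supports.
Context d {X : measurableType d} {R : realType}.
Variables (mu : {measure set X -> \bar R}) (p : R) (p1 : 1 <= p).
Variables (k : nat) (C : nat -> set X).
Hypotheses (mC : forall i, measurable (C i)) (tC : trivIset setT C).

Let p0 : 0 < p. Proof. exact: lt_le_trans ltr01 p1. Qed.

Variable f : nat -> cLfunType mu p1.
Hypothesis f0 : forall i x, ~ C i x -> val (f i) x = 0.
Hypothesis f1 : forall i, rnorm (cLclass (f i)) <= 1.

Let val_sum (c : nat -> R[i]) x :
  val (\sum_(i < k) c i *: f i) x = \sum_(i < k) c i * val (f i) x.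
Proof.
apply: (big_ind2 (fun (g : cLfunType mu p1) r => val g x = r)) => [|g r h s gr hs|i _].
- by rewrite GRing.val0.
- by rewrite GRing.valD -gr -hs.
- by rewrite GRing.valZ.
Qed.

(** At each point at most one term of the sum is nonzero, so the p-th power passes inside. *)
Let normc_val_sum (c : nat -> R[i]) x :
  normc (val (\sum_(i < k) c i *: f i) x) `^ p =
  \sum_(i < k) normc (c i) `^ p * normc (val (f i) x) `^ p.
Proof.
rewrite val_sum; have [[i Cix]|nC] := pselect (exists i : 'I_k, C i x).
  have fj (j : 'I_k) : j != i -> val (f j) x = 0.
    move=> ji; apply: f0 => Cjx; move/trivIsetP : tC => /(_ j i I I ji).
    by move/seteqP => [/(_ x)+ _]; apply.
  rewrite (bigD1 i)//= big1 ?addr0; last by move=> j /fj ->; rewrite mulr0.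
  rewrite [RHS](bigD1 i)//= [X in _ + X]big1 ?addr0; last first.
    by move=> j /fj ->; rewrite ComplexField.Normc.normc0 powR0 ?mulr0 ?gt_eqF.
  by rewrite ComplexField.Normc.normcM powRM ?normc_ge0.
have fj (j : 'I_k) : val (f j) x = 0 by apply: f0 => ?; apply: nC; exists j.
rewrite !big1 ?ComplexField.Normc.normc0 ?powR0 ?gt_eqF//.
- by move=> j _; rewrite fj ComplexField.Normc.normc0 powR0 ?mulr0 ?gt_eqF.
- by move=> j _; rewrite fj mulr0.
Qed.

Let cLclass_sum (c : nat -> R[i]) :
  cLclass (\sum_(i < k) c i *: f i) = \sum_(i < k) c i *: cLclass (f i).
Proof.
apply: (big_ind2 (fun g F => cLclass g = F)) => [|g F h G <- <-|i _].
- by rewrite -(scale0r (0 : cLfunType mu p1)) cLclassZ scale0r.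
- by rewrite cLclassD.
- by rewrite cLclassZ.
Qed.

Lemma rnorm_disjoint_sum (c : nat -> R[i]) :
  rnorm (\sum_(i < k) c i *: cLclass (f i)) `^ p <= \sum_(i < k) normc (c i) `^ p.
Proof.
rewrite -lee_fin -cLclass_sum rnorm_cLclass -sumEFin.
under eq_integral => x _ do rewrite normc_val_sum -sumEFin.
rewrite ge0_integral_sum//; last 2 first.
- move=> i; have [mf _] := cLfunP (f i); under eq_fun do rewrite EFinM.
  by apply: emeasurable_funM => //; exact: measurable_normcX.
- by move=> i x _; rewrite lee_fin mulr_ge0// powR_ge0.
apply: lee_sum => i _; have [mf _] := cLfunP (f i).
under eq_integral do rewrite EFinM.
rewrite ge0_integralZl//; last 3 first.
- exact: measurable_normcX.
- by move=> x _; rewrite lee_fin powR_ge0.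
- by rewrite lee_fin powR_ge0.
rewrite -rnorm_cLclass -EFinM lee_fin ler_piMr ?powR_ge0//.
have <- : 1 `^ p = 1 :> R by rewrite powR1.
by apply: ge0_ler_powR; rewrite ?nnegrE ?rnorm_ge0 ?(ltW p0).
Qed.

Variables (q : R) (q1 : 1 <= q) (qp : q <= p).

Lemma functional_disjoint_sum (phi : {linear cLspace mu p1 -> R[i]^o}) (z : cLspace mu q1) :
  bounded_op phi ->
  \sum_(i < k) rnorm (phi (cLclass (f i))) * rnorm (restr (mC i) z) <=
  op_norm phi * rnorm z.
Proof.
have p_gt0 := p0.
move=> bphi.
(* [e] is |c|/c for c = phi (f i), or 0 if c = 0; it aligns the phases so that the values of [phi]
   add up without cancellation. *)
have e_ex i : exists e : R[i], normc e <= 1 /\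
    e * phi (cLclass (f i)) = (normc (phi (cLclass (f i)) : R[i]))%:C.
  set c : R[i] := phi _; have [->|c0] := eqVneq c 0.
    exists 0; rewrite mul0r ComplexField.Normc.normc0; split => //.
  exists (c^-1 * (normc c)%:C).
  rewrite ComplexField.Normc.normcM ComplexField.Normc.normcV normc_real ?normc_ge0//.
  split; last by rewrite mulrAC mulVf// mul1r.
  rewrite mulVf//; apply: contra_neq c0; exact: ComplexField.Normc.eq0_normc.
have {e_ex} /choice[e e_] := e_ex.
pose a i := rnorm (restr (mC i) z : cLspace mu q1).
have a0 i : 0 <= a i by exact: rnorm_ge0.
pose g : cLspace mu p1 := \sum_(i < k) (e i * (a i)%:C) *: cLclass (f i).
have phig : rnorm (phi g) = \sum_(i < k) rnorm (phi (cLclass (f i))) * a i.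
  rewrite linear_sum/= rnorm_regular.
  rewrite (_ : \sum_(i < k) _ = (\sum_(i < k) rnorm (phi (cLclass (f i))) * a i)%:C).
    by rewrite normc_real// sumr_ge0// => i _; rewrite mulr_ge0 ?rnorm_ge0.
  rewrite rmorph_sum; apply: eq_bigr => i _.
  rewrite linearZ/= rnorm_regular rmorphM/=; have [_ <-] := e_ i.
  exact: mulrAC.
rewrite -phig (le_trans (op_norm_bound bphi _))// ler_wpM2l ?op_norm_ge0//.
apply: (@powR_le_inj _ p); rewrite ?rnorm_ge0//.
apply: le_trans (rnorm_disjoint_sum (fun i => e i * (a i)%:C)) _.
(* Here q <= p enters: a_i <= |z| gives a_i^p <= a_i^q |z|^(p-q), and the a_i^q add up to at most
   |z|^q. *)
apply: (@le_trans _ _ (\sum_(i < k) a i `^ q * rnorm z `^ (p - q))).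
  apply: ler_sum => i _; have [ei _] := e_ i.
  apply: (@le_trans _ _ (a i `^ p)).
    apply: ge0_ler_powR; rewrite ?nnegrE ?normc_ge0 ?(ltW p_gt0)//.
    by rewrite ComplexField.Normc.normcM normc_real// ler_piMl.
  have [->|ai0] := eqVneq (a i) 0.
    by rewrite powR0 ?gt_eqF// mulr_ge0 ?powR_ge0.
  have -> : a i `^ p = a i `^ q * a i `^ (p - q).
    by rewrite -powRD ?ai0 ?implybT// addrC subrK.
  rewrite ler_wpM2l ?powR_ge0//.
  apply: ge0_ler_powR; rewrite ?nnegrE ?subr_ge0 ?rnorm_ge0//.
  exact: rnorm_restr_le.
rewrite -mulr_suml.
have [z0|z0] := eqVneq (rnorm z) 0.
  rewrite big1 ?mul0r ?powR_ge0// => i _; suff -> : a i = 0.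
    by rewrite powR0// gt_eqF// (lt_le_trans ltr01).
  by apply/eqP; rewrite eq_le a0 andbT -z0 rnorm_restr_le.
apply: (@le_trans _ _ (rnorm z `^ q * rnorm z `^ (p - q))).
  by rewrite ler_wpM2r ?powR_ge0//; exact: sum_rnorm_restr.
by rewrite -powRD ?z0 ?implybT// addrC subrK.
Qed.

End disjoint_supports.

Section nuclear_bound.
Context d {X : measurableType d} {R : realType}.
Variables (mu : {measure set X -> \bar R}) (p q : R).
Variables (p1 : 1 <= p) (q1 : 1 <= q) (qp : q <= p).

(** [N] is the nuclear sum of one representation of [T], hence independent of the sets and the
    functions. The partial sums of the representation satisfy the bound, and it passes to the limit
    because only [k] functions are involved. *)
Lemma nuclear_disjoint_bound (T : cLspace mu p1 -> cLspace mu q1) : nuclear T ->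
  exists N : R, forall (k : nat) (C : nat -> set X) (mC : forall i, measurable (C i)),
    trivIset setT C -> forall f : nat -> cLfunType mu p1,
    (forall i x, ~ C i x -> val (f i) x = 0) ->
    (forall i, rnorm (cLclass (f i)) <= 1) ->
    \sum_(i < k) rnorm (restr (mC i) (T (cLclass (f i)))) <= N.
Proof.
move=> [phi [z [bphi phiz Tphi]]].
pose M := (\sum_(n <oo) (op_norm (phi n) * rnorm (z n))%:E)%E.
have M0 n : (0 <= (op_norm (phi n) * rnorm (z n))%:E)%E.
  by rewrite lee_fin mulr_ge0 ?op_norm_ge0 ?rnorm_ge0.
have Mfin : M \is a fin_num by rewrite ge0_fin_numE// nneseries_ge0.
exists (fine M) => k C mC tC f f0 f1.
pose S y n : cLspace mu q1 := series (fun n => (phi n y : R[i]) *: z n) n.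
have bound n : \sum_(i < k) rnorm (restr (mC i) (S (cLclass (f i)) n)) <= fine M.
  apply: (@le_trans _ _ (\sum_(m < n) op_norm (phi m) * rnorm (z m))); last first.
    rewrite -lee_fin fineK// -sumEFin
      -(big_mkord xpredT (fun m => (op_norm (phi m) * rnorm (z m))%:E)).
    exact: nneseries_lim_ge.
  apply: (@le_trans _ _ (\sum_(i < k) \sum_(m < n)
      rnorm (phi m (cLclass (f i))) * rnorm (restr (mC i) (z m)))).
    apply: ler_sum => i _; rewrite /S seriesEord/= linear_sum.
    apply: le_trans (rnorm_sum _ (fun m => restr (mC i) (phi m (cLclass (f i)) *: z m))) _.
    by apply: ler_sum => m _; rewrite linearZ/= rnormZ rnorm_regular.
  rewrite exchange_big/=; apply: ler_sum => m _.
  exact: functional_disjoint_sum.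
apply/ler_addgt0Pr => e e0.
(* [k.+1] covers the case [k = 0]; the [k] errors add up to at most [e]. *)
have e'0 : 0 < e / k.+1%:R by rewrite divr_gt0.
have [n [_]] : exists n, setT n /\ forall i : 'I_k,
    rnorm (T (cLclass (f i)) - S (cLclass (f i)) n) <= e / k.+1%:R.
  have : \forall n \near \oo, forall i : 'I_k,
      rnorm (T (cLclass (f i)) - S (cLclass (f i)) n) <= e / k.+1%:R.
    apply: filter_forall => i.
    have /cvgrPdist_le/(_ (e / k.+1%:R)%:C) := Tphi (cLclass (f i)).
    rewrite ltcR => /(_ e'0); apply: filterS => n.
    by rewrite normr_rnorm lecR.
  by case=> n _ /(_ n (leqnn n)) h; exists n.
move=> Sn; apply: (@le_trans _ _ (\sum_(i < k)
    (rnorm (restr (mC i) (S (cLclass (f i)) n)) + e / k.+1%:R))).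
  apply: ler_sum => i _.
  rewrite -[X in restr _ X](subrK (S (cLclass (f i)) n)) linearD addrC.
  apply: le_trans (rnormD _ _) _; rewrite lerD2l.
  exact: le_trans (rnorm_restr_le _ _) (Sn i).
rewrite big_split/=; apply: lerD => //.
rewrite sumr_const card_ord -[leLHS]mulr_natr -mulrA ler_piMr // ?(ltW e0)//.
by rewrite mulrC ler_pdivrMr// mul1r ler_nat.
Qed.

End nuclear_bound.

(** * Test functions *)

Section WCE.
Context d (X : measurableType d) (R : realType).
Variables (mu : {measure set X -> \bar R}) (A : set (set X)).
Hypotheses (sA : sigma_algebra [set: X] A) (A_sub : A `<=` measurable).
Hypothesis sf : sigma_finite [set: g_sigma_algebraType A] mu.

Lemma funepos_fin (g : X -> R) x : (0 <= (EFin \o g)^\+ x < +oo)%E.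
Proof. by rewrite funepos_ge0/= funeposE/= -EFin_max ltry. Qed.

Lemma funeneg_fin (g : X -> R) x : (0 <= (EFin \o g)^\- x < +oo)%E.
Proof. by rewrite funeneg_ge0/= funenegE/= -EFin_max ltry. Qed.

Lemma eq_rcond_exp (g h : X -> R) : measurable_fun setT g -> measurable_fun setT h ->
  {ae mu, forall x, g x = h x} -> rcond_exp mu A g = rcond_exp mu A h.
Proof.
move=> /measurable_EFinP mg /measurable_EFinP mh gh; rewrite /rcond_exp.
congr (fun a b x => fine (a x) - fine (b x)); apply: eq_cond_exp => //.
- exact: measurable_funepos.
- exact: measurable_funepos.
- by apply: filterS gh => x; rewrite !funeposE/= => ->.
- exact: measurable_funeneg.
- exact: measurable_funeneg.
- by apply: filterS gh => x; rewrite !funenegE/= => ->.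
Qed.

Lemma eq_ccond_exp (g h : X -> R[i]) : cmeasurable g -> cmeasurable h ->
  {ae mu, forall x, g x = h x} -> ccond_exp mu A g = ccond_exp mu A h.
Proof.
move=> [gR gI] [hR hI] gh; rewrite /ccond_exp.
congr (fun a b x => a x +i* b x); apply: eq_rcond_exp => //.
  by apply: filterS gh => x ->.
by apply: filterS gh => x ->.
Qed.

Lemma ccond_exp_real (g : X -> R) : (forall x, 0 <= g x) -> measurable_fun setT g ->
    {ae mu, forall x, (cond_exp mu A (fun y => (g y)%:E) x < +oo)%E} ->
  {ae mu, forall x, ccond_exp mu A (fun y => (g y)%:C) x =
    (fine (cond_exp mu A (fun y => (g y)%:E) x))%:C}.
Proof.
move=> g0 mg goo; rewrite /ccond_exp /rcond_exp /=.
have -> : (EFin \o g)^\+%E = (fun y => (g y)%:E).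
  by apply/funext => x; rewrite funeposE/= max_l ?lee_fin.
have -> : (EFin \o g)^\-%E = cst 0%E.
  by apply/funext => x; rewrite funenegE/= max_r// lee_fin oppr_le0.
have -> : (EFin \o (fun=> 0%R : R))^\+%E = cst 0%E :> (X -> _).
  by apply/funext => x; rewrite funeposE/= maxxx.
have -> : (EFin \o (fun=> 0%R : R))^\-%E = cst 0%E :> (X -> _).
  by apply/funext => x; rewrite funenegE/= oppr0 maxxx.
(* The chosen version of E(0) is known to vanish only almost everywhere. *)
have /cond_exp_eq0 : forall x : X, (0 <= cst (0 : \bar R) x < +oo)%E.
  by move=> x; rewrite lexx ltry.
move=> /(_ mu A sA A_sub sf (measurable_cst _) setT).
have AT : A setT by rewrite -(measurable_subE sA).
move=> /(_ AT)[+ _] => /(_ (aeW _ (fun x _ => erefl))).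
apply: filterS => x ->//.
by rewrite subrr subr0.
Qed.

Section operator.
Variables (p q : R) (p1 : 1 <= p) (q1 : 1 <= q) (w u : X -> R[i]).
Hypotheses (w_meas : cmeasurable w) (u_meas : cmeasurable u).
Variable T : {linear cLspace mu p1 -> cLspace mu q1}.
Hypothesis T_WCE : is_WCE A w u T.

Lemma cmeasurableM (f g : X -> R[i]) : cmeasurable f -> cmeasurable g ->
  cmeasurable (fun x => f x * g x).
Proof.
move=> [fR fI] [gR gI]; split.
  rewrite (_ : (fun x => _) = (fun x => complex.Re (f x) * complex.Re (g x)) \-
     (fun x => complex.Im (f x) * complex.Im (g x))).
    by apply: measurable_funB; exact: measurable_funM.
  by apply/funext => x /=; case: (f x) (g x) => ? ? [].
rewrite (_ : (fun x => _) = (fun x => complex.Re (f x) * complex.Im (g x)) \+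
   (fun x => complex.Im (f x) * complex.Re (g x))).
  by apply: measurable_funD; exact: measurable_funM.
by apply/funext => x /=; case: (f x) (g x) => ? ? [].
Qed.

(** [is_WCE] speaks of the representative [cLspace_fun]; here its two clauses are moved to an
    arbitrary member of the class, so that they apply to explicit test functions. *)
Lemma WCE_class (f : cLfunType mu p1) :
  {ae mu, forall x, (cond_exp mu A (fun y => (normc (u y * val f y))%:E) x < +oo)%E} /\
  {ae mu, forall x, cLspace_fun (T (cLclass f)) x =
    w x * ccond_exp mu A (fun y => u y * val f y) x}.
Proof.
have [mf _] := cLfunP f; have muf := cmeasurableM u_meas mf.
have := cLclassK f; have [[muF]] := T_WCE (cLclass f).
set F := cLspace_fun _ in muF * => ufoo TF Ff.
have e : {ae mu, forall x, u x * F x = u x * val f x} by apply: filterS Ff => x ->.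
split; last by rewrite -(eq_ccond_exp muF muf e); exact: TF.
rewrite -(@eq_cond_exp _ _ _ _ _ A_sub (fun y => (normc (u y * F y))%:E))//.
- exact/measurable_EFinP/measurable_normc.
- exact/measurable_EFinP/measurable_normc.
- by apply: filterS e => x ->.
Qed.

Variable p' : R.
Hypothesis pp' : p^-1 + p'^-1 = 1.
Hypothesis p_gt1 : 1 < p.

Let p0 : 0 < p. Proof. exact: lt_trans ltr01 p_gt1. Qed.

Let p'_gt0 : 0 < p'.
Proof.
by rewrite -invr_gt0 -(ltrD2l p^-1) pp' addr0 invf_lt1.
Qed.

(** This turns the p-th power of a test function, of modulus |u|^(p'-1), into |u|^p'. *)
Let p'E : (p' - 1) * p = p'.
Proof.
have e : p * p' * (p^-1 + p'^-1) = p' + p by field; rewrite !gt_eqF.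
by rewrite mulrBl mul1r [p' * p]mulrC -[p * p']mulr1 -pp' e addrK.
Qed.

Section test_function.
Variables (M : R) (C : set X).
Hypotheses (AC : A C) (Coo : (mu C < +oo)%E).

(** Being bounded by M^p', it is integrable over every set of finite measure, which |u|^p' need not
    be. *)
Definition trunc_weight x : R :=
  normc (u x) `^ p' * \1_[set y | normc (u y) <= M] x.

(** The equality case of Hoelder's inequality: u f and |f|^p are both equal to the truncated |u|^p'
    on [C]. A negative exponent p' - 2 does no harm at the zeros of [u], where the conjugate
    vanishes. *)
Definition test_fun x : R[i] :=
  (u x)^* * (normc (u x) `^ (p' - 2) * \1_([set y | normc (u y) <= M] `&` C) x)%:C.

Let mC : measurable C. Proof. exact: A_sub. Qed.

Let mM : measurable [set y | normc (u y) <= M].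
Proof.
rewrite -[X in measurable X]setTI; apply: measurable_fun_le => //.
exact: measurable_normc.
Qed.

Lemma measurable_trunc_weight : measurable_fun setT trunc_weight.
Proof.
apply: measurable_funM; last exact: measurable_indic.
apply: (@measurableT_comp _ _ _ _ _ _ (@powR R ^~ p')); first exact: measurable_powR.
exact: measurable_normc.
Qed.

Lemma trunc_weight_ge0 x : 0 <= trunc_weight x.
Proof. by rewrite mulr_ge0 ?powR_ge0. Qed.

Lemma trunc_weight_le x : trunc_weight x <= M `^ p'.
Proof.
rewrite /trunc_weight indicE; case: (boolP (x \in _)) => [|_]; last first.
  by rewrite mulr0 powR_ge0.
rewrite inE/= mulr1 => uM; apply: ge0_ler_powR; rewrite ?nnegrE ?normc_ge0 ?(ltW p'_gt0)//.
exact: le_trans (normc_ge0 _) uM.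
Qed.

Let mul_indic x (a : R) : a * \1_([set y | normc (u y) <= M] `&` C) x =
  a * \1_[set y | normc (u y) <= M] x * \1_C x.
Proof. by rewrite indicI mulrA. Qed.

Lemma cmeasurable_test_fun : cmeasurable test_fun.
Proof.
have [uR uI] := u_meas; apply: cmeasurableM.
  split.
    rewrite (_ : (fun x => _) = (fun x => complex.Re (u x)))//.
    by apply/funext => x; case: (u x).
  rewrite (_ : (fun x => _) = (fun x => - complex.Im (u x))).
    exact: measurableT_comp.
  by apply/funext => x; case: (u x).
split => /=; last exact: measurable_cst.
apply: measurable_funM; last by apply: measurable_indic; exact: measurableI.
apply: (@measurableT_comp _ _ _ _ _ _ (@powR R ^~ (p' - 2))); first exact: measurable_powR.
exact: measurable_normc.
Qed.

Lemma mul_test_fun x : u x * test_fun x = (trunc_weight x * \1_C x)%:C.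
Proof.
rewrite /test_fun mulrA -sqr_normc normc_normr -rmorphXn -rmorphM/= mul_indic.
rewrite !mulrA /trunc_weight; congr (_ * _ * _)%:C.
have [->|n0] := eqVneq (normc (u x)) 0.
  by rewrite expr0n/= mul0r powR0 ?gt_eqF.
rewrite -powR_mulrn ?normc_ge0// -powRD ?n0 ?implybT//.
by rewrite addrC subrK.
Qed.

Lemma normc_test_fun x : normc (test_fun x) `^ p = trunc_weight x * \1_C x.
Proof.
rewrite /test_fun ComplexField.Normc.normcM normc_real ?mulr_ge0 ?powR_ge0//.
have -> : normc (u x)^* = normc (u x) by apply: complexI; rewrite -!normc_normr normcJ.
rewrite mul_indic /trunc_weight !mulrA.
have [->|n0] := eqVneq (normc (u x)) 0.
  by rewrite !mul0r !powR0 ?gt_eqF// !mul0r.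
have -> : normc (u x) * normc (u x) `^ (p' - 2) = normc (u x) `^ (p' - 1).
  rewrite -[X in X * _]powRr1 ?normc_ge0// -powRD ?n0 ?implybT//.
  by congr (_ `^ _); lra.
rewrite !powRM ?mulr_ge0 ?powR_ge0// -powRrM p'E.
by rewrite !indicE; do 2 case: (_ \in _); rewrite ?powR1 ?powR0 ?gt_eqF.
Qed.

Definition trunc_integral := fine (\int[mu]_(x in C) (trunc_weight x)%:E).

Lemma trunc_weight_integral_le F : A F -> (mu F < +oo)%E ->
  (\int[mu]_(x in F) (trunc_weight x)%:E <= (M `^ p')%:E * mu F)%E.
Proof.
move=> AF Foo; have mF := A_sub AF; rewrite -integral_cst//.
apply: ge0_le_integral => //.
- by move=> x _; rewrite lee_fin trunc_weight_ge0.
- by apply/measurable_EFinP/measurable_funTS; exact: measurable_trunc_weight.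
- by move=> x _; rewrite lee_fin trunc_weight_le.
Qed.

Lemma trunc_integralE :
  (trunc_integral%:E = \int[mu]_(x in C) (trunc_weight x)%:E)%E.
Proof.
rewrite /trunc_integral fineK// ge0_fin_numE; last first.
  by apply: integral_ge0 => x _; rewrite lee_fin trunc_weight_ge0.
apply: le_lt_trans (trunc_weight_integral_le AC Coo) _.
by rewrite lte_mul_pinfty ?lee_fin ?powR_ge0.
Qed.

Let integral_indic F : (\int[mu]_(x in F) (trunc_weight x * \1_C x)%:E =
  \int[mu]_(x in F `&` C) (trunc_weight x)%:E)%E.
Proof.
rewrite integral_mkcondr; apply: eq_integral => x _; rewrite patchE indicE.
by case: ifPn; rewrite ?mulr1 ?mulr0.
Qed.

Lemma integral_test_fun :
  (\int[mu]_x (normc (test_fun x) `^ p)%:E = trunc_integral%:E)%E.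
Proof.
under eq_integral do rewrite normc_test_fun.
by rewrite integral_indic setTI trunc_integralE.
Qed.

Definition test_cLfun : cLfunType mu p1 :=
  mk_cLfun p1 cmeasurable_test_fun (eq_ind_r (fun a => a < +oo)%E (ltry _) integral_test_fun).

Lemma rnorm_test_cLfun : rnorm (cLclass test_cLfun) = trunc_integral `^ p^-1.
Proof.
rewrite -[LHS]powRr1 ?rnorm_ge0// -(mulfV (lt0r_neq0 p0)) powRrM; congr (_ `^ _).
by apply: EFin_inj; rewrite rnorm_cLclass; exact: integral_test_fun.
Qed.

(** T f = w E(u f), where u f is the truncated weight on [C], and [cond_exp_ge] bounds its
    conditional expectation below by a/2 on [C]; integrating |w|^q over [C] does the rest. *)
Lemma rnorm_T_test (a : R) : 0 <= a ->
    (forall F, A F -> F `<=` C ->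
      a%:E * mu F <= \int[mu]_(x in F) (trunc_weight x)%:E)%E ->
  ((a / 2)%:E * (\int[mu]_(x in C) (normc (w x) `^ q)%:E) `^ q^-1 <=
   (rnorm (restr (A_sub AC) (T (cLclass test_cLfun))))%:E)%E.
Proof.
move=> a0 aF; have [] := WCE_class test_cLfun.
pose g x := trunc_weight x * \1_C x.
have g0 x : 0 <= g x by rewrite mulr_ge0 ?trunc_weight_ge0.
have mg : measurable_fun setT g.
  by apply: measurable_funM; [exact: measurable_trunc_weight|exact: measurable_indic].
have ug x : u x * val test_cLfun x = (g x)%:C by exact: mul_test_fun.
rewrite (_ : (fun y => u y * val test_cLfun y) = (fun y => (g y)%:C)); last first.
  by apply/funext => x; exact: ug.
rewrite (_ : (fun y => (normc (u y * val test_cLfun y))%:E) = (fun y => (g y)%:E)); last first.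
  by apply/funext => x; rewrite ug normc_real.
move=> goo Tf.
have Eg : {ae mu, forall x, C x -> ((a / 2)%:E <= cond_exp mu A (fun y => (g y)%:E) x)%E}.
  apply: (cond_exp_ge sA A_sub sf) => //; first exact/measurable_EFinP.
    by move=> x; rewrite lee_fin g0 ltry.
  move=> F AF FC; apply: le_trans (aF _ AF FC) _.
  by rewrite integral_indic (setIidl FC).
have mCw : measurable_fun C (fun x => (normc (w x) `^ q)%:E).
  by apply: measurable_funTS; exact: measurable_normcX.
have a2 : 0 <= a / 2 by rewrite divr_ge0.
have q0 : 0 < q by exact: lt_le_trans ltr01 q1.
have h : (((a / 2) `^ q)%:E * \int[mu]_(x in C) (normc (w x) `^ q)%:E <=
    (rnorm (restr (A_sub AC) (T (cLclass test_cLfun))) `^ q)%:E)%E.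
  rewrite rnorm_restr -ge0_integralZl//; last 2 first.
  - by move=> x _; rewrite lee_fin powR_ge0.
  - by rewrite lee_fin powR_ge0.
  apply: ae_ge0_le_integral => //.
  - by move=> x _; rewrite -EFinM lee_fin mulr_ge0 ?powR_ge0.
  - by apply: emeasurable_funM => //; exact: measurable_cst.
  - by move=> x _; rewrite lee_fin powR_ge0.
  - by apply: measurable_funTS; apply: measurable_normcX; exact: cmeasurable_cLspace.
  have Er := ccond_exp_real g0 mg goo.
  apply: (filter_app _ _ Eg); apply: (filter_app _ _ goo); apply: (filter_app _ _ Tf).
  apply: (filter_app _ _ Er); apply: aeW => x e -> gxoo gea Cx.
  rewrite -EFinM lee_fin -powRM ?normc_ge0// ComplexField.Normc.normcM e.
  apply: ge0_ler_powR; rewrite ?nnegrE ?mulr_ge0 ?normc_ge0 ?(ltW q0)//.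
  rewrite mulrC ler_wpM2l ?normc_ge0// normc_real; last first.
    by rewrite fine_ge0// (le_trans _ (gea Cx)).
  rewrite -lee_fin fineK ?gea// ge0_fin_numE//.
  by rewrite (le_trans _ (gea Cx)).
have := @gt0_ler_poweR _ q^-1 _ _ _ _ _ h.
rewrite poweRM ?lee_fin ?powR_ge0//; last first.
  by apply: integral_ge0 => x _; rewrite lee_fin powR_ge0.
rewrite !poweR_EFin -!powRrM mulfV ?gt_eqF// !powRr1 ?rnorm_ge0//; apply.
- by rewrite invr_ge0 ltW.
- rewrite in_itv/= leey andbT mule_ge0 ?lee_fin ?powR_ge0//.
  by apply: integral_ge0 => x _; rewrite lee_fin powR_ge0.
- by rewrite in_itv/= leey andbT lee_fin powR_ge0.
Qed.

End test_function.

End operator.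
End WCE.

(** * Partitions of non-atomic sets *)

Section nonatomic_partition.
Context d (X : measurableType d) (R : realType).
Variables (mu : {measure set X -> \bar R}) (A : set (set X)).
Hypotheses (sA : sigma_algebra [set: X] A) (A_sub : A `<=` measurable).
Implicit Types (C D E F G : set X).

Let AI F G : A F -> A G -> A (F `&` G).
Proof. by rewrite -!(measurable_subE sA) => ? ?; exact: measurableI. Qed.

Let AD F G : A F -> A G -> A (F `\` G).
Proof. by rewrite -!(measurable_subE sA) => ? ?; exact: measurableD. Qed.

Let A0 : A set0.
Proof. by rewrite -(measurable_subE sA). Qed.

Let AU F G : A F -> A G -> A (F `|` G).
Proof. by rewrite -!(measurable_subE sA) => ? ?; exact: measurableU. Qed.

Variable B : set X.
Hypothesis B_nonatomic : nonatomic mu A B.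

(** As [D] is not an atom, it splits into two parts of positive measure, and one of them has at most
    half the measure of [D]. *)
Lemma nonatomic_half D : A D -> D `<=` B -> (0 < mu D < +oo)%E ->
  exists G, [/\ A G, G `<=` D, (0 < mu G)%E & (mu G *+ 2 <= mu D)%E].
Proof.
move=> AD' DB /andP[D0 Doo].
have [G [AG GD G0 GDn]] : exists G, [/\ A G, G `<=` D, mu G <> 0%E & mu G <> mu D].
  apply: contrapT => nG; apply: (B_nonatomic DB); split => // G AG GD.
  have [|G0] := pselect (mu G = 0%E); first by left.
  have [|GDn] := pselect (mu G = mu D); first by right.
  by case: nG; exists G.
have mD := A_sub AD'; have mG := A_sub AG.
have Goo : (mu G < +oo)%E by apply: le_lt_trans Doo; rewrite le_measure ?inE.
have DGE : mu (D `\` G) = (mu D - mu G)%E.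
  by rewrite measureD// (setIidr GD).
have : (0 <= mu G)%E by []. have : (mu G <= mu D)%E by rewrite le_measure ?inE.
case: (mu D) D0 Doo GDn DGE => [y| |]// y0 _; case EG : (mu G) G0 Goo => [z| |]// z0 _.
rewrite -EFinB !lte_fin !lee_fin in y0 * => zy DGE zley z_ge0.
have {}zy : z != y by apply: contra_not_neq zy => ->.
have {}z0 : z != 0 by apply: contra_not_neq z0 => ->.
have [zh|zh] := leP (z *+ 2) y.
  exists G; split => //; rewrite EG ?lte_fin; first by rewrite lt_neqAle eq_sym z0.
  by rewrite -EFin_natmul lee_fin.
exists (D `\` G); split => //; first exact: AD.
  by rewrite DGE lte_fin subr_gt0 lt_neqAle zy.
by rewrite DGE -EFin_natmul lee_fin mulr2n; rewrite mulr2n in zh; lra.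
Qed.

(** Repeated halving, by induction on an n with mu(D) <= e 2^n. *)
Lemma nonatomic_small D (e : R) : A D -> D `<=` B -> (0 < mu D < +oo)%E -> 0 < e ->
  exists G, [/\ A G, G `<=` D, (0 < mu G)%E & (mu G <= e%:E)%E].
Proof.
move=> AD' DB D0oo e0.
have [n Dn] : exists n, (mu D <= (e *+ 2 ^ n)%:E)%E.
  have /andP[_ Doo] := D0oo.
  exists (Num.truncn (fine (mu D) / e)).+1.
  rewrite -[X in (X <= _)%E]fineK ?ge0_fin_numE// lee_fin.
  rewrite -[X in X <= _](divfK (lt0r_neq0 e0)) -[leRHS]mulr_natl ler_wpM2r ?ltW//.
  apply: (lt_le_trans (archimedean.Num.Theory.truncnS_gt _)).
  by rewrite ler_nat ltnW// ltn_expl.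
elim: n => [|n IH] in D AD' DB D0oo Dn *.
  by exists D; split => //; case/andP: D0oo.
have [G [AG GD G0 GE]] := nonatomic_half AD' DB D0oo.
have /andP[_ Doo] := D0oo.
have Goo : (mu G < +oo)%E.
  by apply: le_lt_trans Doo; rewrite le_measure ?inE//; exact: A_sub.
have [||F [AF FG F0 Fe]] := IH G AG (subset_trans GD DB); last 1 first.
- by exists F; split => //; exact: subset_trans GD.
- by rewrite G0.
have := le_trans GE Dn; rewrite -(@fineK _ (mu G)) ?ge0_fin_numE//.
by rewrite -EFin_natmul !lee_fin expnS mulnC mulrnA ler_pMn2r.
Qed.

(** Exhaustion: the measures of finite unions of pieces of measure at most [e] have supremum mu(C),
    for otherwise [nonatomic_small] would yield one more piece. Covering only half of [C] stays
    strictly below this supremum, so that a finite union suffices. *)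
Lemma nonatomic_partition C (e : R) : A C -> C `<=` B -> (0 < mu C < +oo)%E -> 0 < e ->
  exists k (D : nat -> set X), [/\ trivIset setT D,
    forall i, A (D i) /\ D i `<=` C, forall i, (mu (D i) <= e%:E)%E &
    (mu C <= (\sum_(i < k) mu (D i)) *+ 2)%E].
Proof.
move=> AC CB C0oo e0; have /andP[C0 Coo] := C0oo.
pose piece D := [/\ A D, D `<=` C & (mu D <= e%:E)%E].
have piece0 : piece set0 by split => //; rewrite measure0 lee_fin ltW.
(* The condition ranges over all indices of [nth], so the default [set0] must be a piece too. *)
pose small E := exists2 s : seq (set X),
  (forall i, piece (nth set0 s i)) & E = \big[setU/set0]_(D <- s) D.
have small_piece D : piece D -> small D.
  by move=> pD; exists [:: D]; [case=> [|[|]]|rewrite big_seq1].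
have smallU E F : small E -> small F -> small (E `|` F).
  move=> [s ps ->] [t pt ->]; exists (s ++ t); last by rewrite big_cat.
  by move=> i; rewrite nth_cat; case: ifP.
have smallA E : small E -> A E /\ E `<=` C.
  move=> [s ps ->]; rewrite (big_nth set0) big_mkord; split.
    by apply: (big_ind A) => // i _; case: (ps i).
  apply: (big_ind (fun F => F `<=` C)) => [|F G FC GC|i _].
  - exact: sub0set.
  - by rewrite subUset.
  - by case: (ps i).
have mC := A_sub AC.
have smallC E : small E -> (mu E <= mu C)%E.
  by move=> /smallA[AE EC]; rewrite le_measure ?inE//; exact: A_sub.
pose al := ereal_sup [set mu E | E in small].
have alC : (al <= mu C)%E by apply: ge_ereal_sup => _ [E sE <-]; exact: smallC.
have al0 : (0 <= al)%E.
  by apply: ereal_sup_ubound; exists set0; [exact: small_piece|rewrite measure0].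
have alfin : al \is a fin_num by rewrite ge0_fin_numE//; exact: le_lt_trans Coo.
have /choice[E EE] n : exists E, small E /\ (al - (n.+1%:R^-1)%:E < mu E)%E.
  have [|_ [E sE <-] alE] := @ub_ereal_sup_adherent R [set mu E | E in small] n.+1%:R^-1 _ alfin.
    by rewrite invr_gt0.
  by exists E.
(* Increasing finite unions of pieces, with [G n] within 1/(n+1) of the supremum. *)
pose G n := \big[setU/set0]_(i < n.+1) E i.
have sG n : small (G n).
  rewrite /G; elim: n => [|n IH]; first by rewrite big_ord_recl big_ord0 setU0; case: (EE 0%N).
  by rewrite big_ord_recr/=; apply: smallU => //; case: (EE n.+1).
have mG n : measurable (G n) by apply: A_sub; have [] := smallA _ (sG n).
have muG : (mu (\bigcup_n G n) <= al)%E.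
  apply: (cvge_le _ (@nondecreasing_cvg_mu _ _ _ mu G mG _ _)).
  - by apply: nearW => n; apply: ereal_sup_ubound; exists (G n).
  - exact: bigcup_measurable.
  - by move=> n m nm; apply/subsetPset; apply: subset_bigsetU; rewrite ltnS.
have AG : A (\bigcup_n G n).
  rewrite -(measurable_subE sA); apply: bigcup_measurable => n _.
  by rewrite measurable_subE//; have [] := smallA _ (sG n).
have CG0 : mu (C `\` \bigcup_n G n) = 0%E.
  apply/eqP; rewrite eq_le measure_ge0 andbT leNgt; apply/negP => CG.
  have [||F [AF FC F0 Fe]] := @nonatomic_small (C `\` \bigcup_n G n) e (AD AC AG) _ _ e0.
  - by apply: subset_trans CB; exact: subDsetl.
  - rewrite CG/=; apply: le_lt_trans Coo; rewrite le_measure ?inE//.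
    by apply: A_sub; exact: AD.
  have sF : small F.
    by apply: small_piece; split => //; apply: (subset_trans FC); exact: subDsetl.
  have mF := A_sub AF.
  have Foo : (mu F < +oo)%E by apply: le_lt_trans Fe _; rewrite ltry.
  (* For such an n, adding [F] to [G n] would exceed the supremum. *)
  have [n Fn] : exists n, ((n.+1%:R^-1)%:E <= mu F)%E.
    exists (Num.truncn (fine (mu F))^-1).
    rewrite -[X in (_ <= X)%E]fineK ?ge0_fin_numE// lee_fin -[leRHS]invrK
      lef_pV2 ?posrE ?invr_gt0 ?fine_gt0 ?F0//.
    exact/ltW/archimedean.Num.Theory.truncnS_gt.
  have /(_ (smallU _ _ (sG n) sF)) : small (G n `|` F) -> (mu (G n `|` F) <= al)%E.
    by move=> sGF; apply: ereal_sup_ubound; exists (G n `|` F).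
  rewrite measureU//; last first.
    by apply/seteqP; split => // x [Gx /FC[_]]; apply; exists n.
  apply/negP; rewrite -ltNge; have [_] := EE n; rewrite lteBlDr//.
  move/lt_le_trans; apply; apply: leeD => //.
  apply: le_measure; rewrite ?inE//; first by apply: A_sub; have [] := smallA _ (EE n).1.
  by rewrite /G big_ord_recr/=; exact: subsetUr.
have Cal : (mu C <= al)%E.
  have CE : C = (C `\` \bigcup_n G n) `|` (\bigcup_n G n).
    rewrite setUC setDUK//; apply: bigcup_sub => n _; exact: (smallA _ (sG n)).2.
  rewrite {1}CE; apply: le_trans (measureU2 _ _ _) _ => //.
  - by apply: A_sub; exact: AD.
  - exact: A_sub.
  - by rewrite [X in (X + _)%E]CG0 add0e.
have Cf : mu C = (fine (mu C))%:E by rewrite fineK// ge0_fin_numE.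
have c0 : 0 < fine (mu C) by rewrite fine_gt0// C0.
have : ((fine (mu C) / 2)%:E < al)%E.
  by apply: lt_le_trans Cal; rewrite Cf lte_fin/= ltr_pdivrMr// ltr_pMr// ltr1n.
move=> /ereal_sup_gt[_ [F [s ps ->] <-]].
rewrite (big_nth set0) big_mkord bigsetU_seqDU.
(* The pieces of [s] may overlap; removing from each the preceding ones keeps them in [A] and does
   not increase their measure. *)
pose D := seqDU (nth set0 s).
have AD' i : A (D i).
  rewrite -(measurable_subE sA); apply: measurableD.
    by rewrite measurable_subE//; case: (ps i).
  by apply: bigsetU_measurable => j _; rewrite measurable_subE//; case: (ps j).
have Dp i : D i `<=` nth set0 s i by exact: subDsetl.
rewrite (measure_bigsetU mu (fun i => A_sub (AD' i)) (trivIset_seqDU _)).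
move=> h; exists (size s), D; split.
- exact: trivIset_seqDU.
- by move=> i; split => //; apply: (subset_trans (Dp i)); case: (ps i).
- move=> i; case: (ps i) => Ai _; apply: le_trans; rewrite le_measure ?inE//; exact: A_sub.
rewrite Cf; move: h; case: (\sum_(_ < _) _)%E => [y| |]//.
- by rewrite lte_fin -EFin_natmul lee_fin -[y *+ 2]mulr_natr => ?; lra.
- by rewrite mule2n leey.
Qed.

End nonatomic_partition.

(** * Necessity *)

(** [l] may be infinite. The limits are suprema, and the power map is an increasing bijection of
    [0, +oo] whose inverse is the power 1/a. *)
Lemma poweR_cvg {R : realType} (V : nat -> \bar R) (l : \bar R) (a : R) : 0 < a ->
    (forall n, 0 <= V n)%E -> {homo V : n m / (n <= m)%N >-> (n <= m)%E} ->
  V n @[n --> \oo] --> l -> (V n `^ a)%E @[n --> \oo] --> (l `^ a)%E.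
Proof.
move=> a0 V0 Vnd Vl.
have le_powe (r : R) (x y : \bar R) : 0 < r -> (0 <= x -> x <= y -> x `^ r <= y `^ r)%E.
  move=> r0 x0 xy; apply: gt0_ler_poweR => //; rewrite ?(ltW r0)// in_itv/= leey andbT//.
  exact: le_trans xy.
have Vle n : (V n <= l)%E.
  rewrite -(cvg_lim _ Vl)// (cvg_lim _ (ereal_nondecreasing_cvgn Vnd))//.
  by apply: ereal_sup_ubound; exists n.
suff -> : (l `^ a)%E = ereal_sup (range (fun n => V n `^ a)%E).
  apply: ereal_nondecreasing_cvgn => n m nm.
  by apply: (le_powe _) => //; exact: Vnd.
apply/eqP; rewrite eq_le; apply/andP; split; last first.
  by apply: ge_ereal_sup => _ [n _ <-]; apply: (le_powe _).
set y := ereal_sup _.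
have Vy n : (V n `^ a <= y)%E by apply: ereal_sup_ubound; exists n.
have y0 : (0 <= y)%E by apply: le_trans (Vy 0%N); exact: poweR_ge0.
have K (x : \bar R) (r : R) : 0 < r -> (0 <= x)%E -> ((x `^ r) `^ r^-1 = x)%E.
  by move=> r0 x0; rewrite -poweRrM mulfV ?gt_eqF// poweRe1.
have l0 : (0 <= l)%E by exact: le_trans (Vle 0%N).
rewrite -[leRHS](K _ a^-1) ?invr_gt0// invrK; apply: (le_powe _) => //.
apply: (cvge_le _ Vl); apply: nearW => n.
by rewrite -[leLHS](K _ a)//; apply: (le_powe _); rewrite ?invr_gt0// poweR_ge0.
Qed.

(** The product is discontinuous at 0 times infinity, and [x] or [l] may be infinite. The bound V n
    <= l settles the case l = 0, in which every [V n] is 0. *)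
Lemma cvge_mul_ge0 {R : realType} (V : nat -> \bar R) (l x : \bar R) :
    (0 <= x)%E -> (forall n, 0 <= V n <= l)%E ->
  V n @[n --> \oo] --> l -> (x * V n)%E @[n --> \oo] --> (x * l)%E.
Proof.
move=> x0 V0l Vl; have [->|xn0] := eqVneq x 0%E.
  by under eq_fun do rewrite mul0e; rewrite mul0e; exact: cvg_cst.
have [l0|ln0] := eqVneq l 0%E.
  rewrite l0 mule0 (_ : (fun n => _) = cst 0%E); first exact: cvg_cst.
  apply/funext => n; have := V0l n; rewrite l0 -eq_le => /eqP <-.
  by rewrite mule0.
have l_ge0 : (0 <= l)%E by have /andP[V0 /(le_trans V0)] := V0l 0%N.
apply: cvgeM => //; last exact: cvg_cst.
by rewrite mule_defE (negPf xn0) (negPf ln0).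
Qed.

Section forward.
Context d (X : measurableType d) (R : realType).
Variables (mu : {measure set X -> \bar R}) (A : set (set X)).
Hypotheses (sA : sigma_algebra [set: X] A) (A_sub : A `<=` measurable).
Hypothesis sf : sigma_finite [set: g_sigma_algebraType A] mu.
Variables (p q p' : R) (p1 : 1 <= p) (q1 : 1 <= q) (qp : q < p).
Hypothesis pp' : p^-1 + p'^-1 = 1.
Variables (w u : X -> R[i]) (w_meas : cmeasurable w) (u_meas : cmeasurable u).
Variable T : {linear cLspace mu p1 -> cLspace mu q1}.
Hypotheses (T_WCE : is_WCE A w u T) (T_nuclear : nuclear T).

Let p_gt1 : 1 < p. Proof. exact: le_lt_trans qp. Qed.
Let p0 : 0 < p. Proof. exact: lt_trans p_gt1. Qed.
Let q0 : 0 < q. Proof. exact: lt_le_trans q1. Qed.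
Let p'i0 : 0 < p'^-1.
Proof. by rewrite -(ltrD2l p^-1) pp' addr0 invf_lt1. Qed.
Let p'0 : 0 < p'. Proof. by rewrite -invr_gt0. Qed.

Let W F := (\int[mu]_(x in F) (normc (w x) `^ q)%:E)%E.
Let U F := (\int[mu]_(x in F) (normc (u x) `^ p')%:E)%E.
Let V M F := (\int[mu]_(x in F) (trunc_weight u p' M x)%:E)%E.
Let v := trunc_integral mu u p'.

Let W0 F : (0 <= W F)%E.
Proof. by apply: integral_ge0 => x _; rewrite lee_fin powR_ge0. Qed.

Let V0 M F : (0 <= V M F)%E.
Proof. by apply: integral_ge0 => x _; rewrite lee_fin trunc_weight_ge0. Qed.

Let v0 M F : 0 <= v M F.
Proof. exact/fine_ge0/V0. Qed.

Let vE M F : A F -> (mu F < +oo)%E -> (v M F)%:E = V M F.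
Proof. by move=> AF Foo; exact: (trunc_integralE A_sub u_meas pp' p_gt1). Qed.

(** The test function on [C i] has norm v^(1/p), hence the normalising factor v^(-1/p); a_i / 2
    comes from [rnorm_T_test]. [N] is uniform in the cut-off [M], which can therefore be sent to
    infinity. *)
Lemma nuclear_WCE_bound : exists N : R, forall k (C : nat -> set X) (a : nat -> R) (M : R),
    trivIset setT C -> (forall i, A (C i)) -> (forall i, (mu (C i) < +oo)%E) ->
    (forall i, 0 <= a i) ->
    (forall i F, A F -> F `<=` C i -> ((a i)%:E * mu F <= V M F)%E) ->
  (\sum_(i < k) (a i / 2 * v M (C i) `^ (- p^-1))%:E * W (C i) `^ q^-1 <= N%:E)%E.
Proof.
have [N NP] := nuclear_disjoint_bound (ltW qp) T_nuclear.
exists N => k C a M tC AC Coo a0 aC.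
pose tf i := test_cLfun A_sub p1 u_meas pp' p_gt1 M (AC i) (Coo i).
pose c i := v M (C i) `^ (- p^-1).
have c0 i : 0 <= c i by exact: powR_ge0.
pose f i := (c i)%:C *: tf i.
have fE i : cLclass (f i) = (c i)%:C *: cLclass (tf i) by rewrite -cLclassZ.
have f0 i x : ~ C i x -> val (f i) x = 0.
  move=> nCx; rewrite GRing.valZ.
  rewrite [LHS](_ : _ = (c i)%:C * test_fun u p' M (C i) x)//.
  by rewrite /test_fun indicE memNset ?mulr0 ?rmorph0 ?mulr0// => -[].
have f1 i : rnorm (cLclass (f i)) <= 1.
  rewrite fE rnormZ normc_real// rnorm_test_cLfun -/(v _ _) /c.
  have [->|v_neq0] := eqVneq (v M (C i)) 0.
    by rewrite [X in _ * X]powR0 ?mulr0// invr_neq0 ?gt_eqF.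
  by rewrite -powRD ?v_neq0 ?implybT// addNr powRr0.
have := NP k C (fun i => A_sub (AC i)) tC f f0 f1.
rewrite -lee_fin -sumEFin; apply: le_trans; apply: lee_sum => i _.
rewrite fE linearZ/= linearZ/= rnormZ normc_real//.
rewrite [a i / 2 * _]mulrC 2!(EFinM (c i)) -muleA lee_wpmul2l ?lee_fin//.
apply: (rnorm_T_test sA A_sub sf) => //; exact: aC.
Qed.



Let mV M F : measurable_fun F (fun x => (trunc_weight u p' M x)%:E).
Proof. by apply/measurable_EFinP/measurable_funTS; exact: measurable_trunc_weight. Qed.

Let trunc_weight_nd x n m :
  (n <= m)%N -> trunc_weight u p' n%:R x <= trunc_weight u p' m%:R x.
Proof.
move=> nm; rewrite ler_wpM2l ?powR_ge0// !indicE ler_nat.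
case: (boolP (x \in [set y | normc (u y) <= n%:R])) => //; rewrite inE/= => un.
by rewrite mem_set//=; apply: (le_trans un); rewrite ler_nat.
Qed.

Let V_nd F : measurable F -> {homo (fun n => V n%:R F) : n m / (n <= m)%N >-> (n <= m)%E}.
Proof.
move=> mF n m nm; apply: ge0_le_integral => //.
- by move=> x _; rewrite lee_fin trunc_weight_ge0.
- by move=> x _; rewrite lee_fin trunc_weight_nd.
Qed.

Let V_le_U M F : measurable F -> (V M F <= U F)%E.
Proof.
move=> mF; apply: ge0_le_integral => //.
- by move=> x _; rewrite lee_fin trunc_weight_ge0.
- by apply: measurable_funTS; exact: measurable_normcX.
- by move=> x _; rewrite lee_fin ler_piMr ?powR_ge0// indicE lern1 leq_b1.
Qed.

Lemma trunc_weight_cvg F : measurable F -> V n%:R F @[n --> \oo] --> U F.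
Proof.
move=> mF.
have := @cvg_monotone_convergence _ _ _ mu F mF (fun n x => (trunc_weight u p' n%:R x)%:E).
rewrite (_ : \int[mu]_(x in F) _ = U F)%E.
  apply.
  - by move=> n; exact: mV.
  - by move=> n x _; rewrite lee_fin trunc_weight_ge0.
  - by move=> x _ n m nm; rewrite lee_fin trunc_weight_nd.
apply: eq_integral => x _; apply: (@lim_near_cst _ _ _ _ _ _ _); first by [].
exists (Num.truncn (normc (u x))).+1 => // n /= nu.
rewrite /trunc_weight indicE mem_set ?mulr1//=.
apply: ltW (lt_le_trans (archimedean.Num.Theory.truncnS_gt _) _).
by rewrite ler_nat.
Qed.

Let p'_mul (x : R) : 0 <= x -> x * x `^ (- p^-1) = x `^ p'^-1.
Proof.
move=> x0; have [->|xn0] := eqVneq x 0; first by rewrite mul0r powR0// gt_eqF.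
rewrite -[X in X * _]powRr1// -powRD ?xn0 ?implybT//.
by congr (_ `^ _); rewrite -pp' addrC addKr.
Qed.

Variables (I : set nat) (At : nat -> set X).
Hypotheses (At_atom : forall i, I i -> atom mu A (At i)) (At_disj : trivIset I At).

Lemma nuclear_atoms_bound : exists N : R, forall k,
  (\sum_(i < k) (if (i : nat) \in I then
     ((fine (mu (At i)))^-1)%:E * (U (At i) `^ p'^-1 * W (At i) `^ q^-1)
   else 0) <= N%:E)%E.
Proof.
have [N NP] := nuclear_WCE_bound; exists (N *+ 2) => k.
(* Empty sets fill the indices outside [I], giving a disjoint sequence over all of [nat]. *)
pose C i := if i \in I then At i else set0.
have AC i : A (C i).
  rewrite /C; case: ifPn; first by rewrite inE => /At_atom[].
  by rewrite -(measurable_subE sA).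
have Coo i : (mu (C i) < +oo)%E.
  rewrite /C; case: ifPn; last by rewrite measure0.
  by rewrite inE => /At_atom; exact: (atom_ltey sA A_sub sf).
have tC : trivIset setT C by have := At_disj; rewrite trivIset_mkcond.
pose m i := fine (mu (C i)).
have m0 i : 0 <= m i by exact: fine_ge0.
have Cfin i : mu (C i) \is a fin_num by rewrite ge0_fin_numE.
have mE i : (m i)%:E = mu (C i) by rewrite fineK.
(* A subset of an atom is null or of full measure, and in both cases the mean of the weight is an
   admissible [a]. *)
have VC M i F : A F -> F `<=` C i -> ((v M (C i) / m i)%:E * mu F <= V M F)%E.
  move=> AF FC; have mF := A_sub AF; have mC := A_sub (AC i).
  have [->|F0] := eqVneq (mu F) 0%E; first by rewrite mule0.
  have iI : i \in I.
    apply: contraT => iI; move: F0 FC; rewrite /C (negPf iI) subset0 => + F0.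
    by rewrite F0 measure0 eqxx.
  have at_i : atom mu A (C i) by rewrite /C iI; apply: At_atom; rewrite -in_setE.
  have FE : mu F = mu (C i) by case: at_i => _ _ /(_ F AF FC)[/eqP|//]; rewrite (negPf F0).
  have m_gt0 : 0 < m i by exact: (fine_atom_gt0 sA A_sub sf at_i).
  rewrite FE -mE -EFinM divfK ?gt_eqF// vE//.
  rewrite -[in leLHS](setDUK FC) /V ge0_integral_setU//.
  - rewrite [X in (_ + X)%E]null_set_integral ?adde0//.
    + exact: measurableD.
    + rewrite (measureD mC mF (Coo i)) (setIidr FC) [X in (_ - X)%E]FE subee//.
      exact: Cfin.
  - exact: measurableD.
  - by move=> x _; rewrite lee_fin trunc_weight_ge0.
  - by apply/disj_setPS => x [Fx [_]].
(* With a = v/m the factor a v^(-1/p) becomes v^(1/p') / m. *)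
have bound n : (\sum_(i < k) (((m i)^-1 / 2)%:E * W (C i) `^ q^-1) *
    V n%:R (C i) `^ p'^-1 <= N%:E)%E.
  have := NP k C (fun i => v n%:R (C i) / m i) n%:R tC AC Coo _ (VC n%:R).
  move=> /(_ (fun i => divr_ge0 (v0 _ _) (m0 i))); apply: le_trans; apply: lee_sum => i _.
  rewrite muleAC lee_wpmul2r ?poweR_ge0//.
  rewrite -vE// poweR_EFin -EFinM lee_fin -p'_mul//.
  lra.
have lim : (\sum_(i < k) (((m i)^-1 / 2)%:E * W (C i) `^ q^-1) *
    U (C i) `^ p'^-1 <= N%:E)%E.
  have bound_near : \forall n \near \oo, (\sum_(i < k) (((m i)^-1 / 2)%:E * W (C i) `^ q^-1) *
      V n%:R (C i) `^ p'^-1 <= N%:E)%E by exact: nearW.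
  apply: (cvge_le bound_near).
  apply: cvg_nnesum => i _.
    apply: nearW => n.
    by rewrite !mule_ge0 ?poweR_ge0// lee_fin divr_ge0// invr_ge0.
  have mCi := A_sub (AC i).
  apply: cvge_mul_ge0.
  - by rewrite mule_ge0 ?poweR_ge0// lee_fin divr_ge0// invr_ge0.
  - move=> n; rewrite poweR_ge0/=; apply: gt0_ler_poweR; rewrite ?(ltW p'i0)//.
    + by rewrite in_itv/= leey andbT.
    + by rewrite in_itv/= leey andbT (le_trans (V0 0 (C i)) (V_le_U 0 mCi)).
    + exact: V_le_U.
  - by apply: poweR_cvg => //; [exact: V_nd|exact: trunc_weight_cvg].
apply: (@le_trans _ _ (N%:E *+ 2)%E); last by rewrite EFin_natmul.
apply: (@le_trans _ _ ((\sum_(i < k) (((m i)^-1 / 2)%:E * W (C i) `^ q^-1) *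
    U (C i) `^ p'^-1) *+ 2)%E); last first.
  by rewrite !mule2n leeD.
rewrite mule2n -big_split/=; apply: lee_sum => i _.
case: ifPn => iI; last first.
  by rewrite adde_ge0// !mule_ge0 ?poweR_ge0// lee_fin divr_ge0// invr_ge0.
rewrite -ge0_muleDl ?mule_ge0 ?poweR_ge0 ?lee_fin ?divr_ge0 ?invr_ge0//.
rewrite -ge0_muleDl ?lee_fin ?divr_ge0 ?invr_ge0// -EFinD -splitr.
by rewrite /m /C iI -muleA [X in (_ <= _ * X)%E]muleC.
Qed.

(** This is 1/r. *)
Let th := q^-1 - p^-1.
Let th1 : th - 1 < 0.
Proof.
have pi0 : 0 < p^-1 by rewrite invr_gt0.
have qi1 : q^-1 <= 1 by rewrite invf_le1.
by rewrite /th; lra.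
Qed.

(** The source of the contradiction: as th - 1 < 0, parts of measure at most e satisfy sum m_i^th >=
    e^(th-1) sum m_i, which blows up as e tends to 0. *)
Let powR_small (m e : R) : 0 < m -> m <= e -> m * e `^ (th - 1) <= m `^ th.
Proof.
move=> m0 me; have e0 := lt_le_trans m0 me; have -> : m `^ th = m `^ (th - 1) * m.
  rewrite -[X in _ * X]powRr1 ?(ltW m0)// -powRD ?subrK//.
  by rewrite (gt_eqF m0) implybT.
rewrite mulrC ler_wpM2r ?(ltW m0)//.
rewrite -(opprB 1 th) !powRN lef_pV2 ?posrE ?powR_gt0//.
apply: ge0_ler_powR => //; rewrite ?nnegrE ?(ltW m0) ?(ltW e0)//.
by rewrite -opprB oppr_ge0 ltW.
Qed.

Lemma bigcup_mu_neq0 D (G : nat -> set X) : measurable D -> (forall k, measurable (G k)) ->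
  D `<=` \bigcup_k G k -> mu D <> 0%E -> exists k, mu (D `&` G k) <> 0%E.
Proof.
move=> mD mG DG; apply: contra_notP => nk.
rewrite -[D](setIidl DG) setI_bigcupr; apply/negligibleP.
  by apply: bigcup_measurable => k _; exact: measurableI.
apply: negligible_bigcup => k; apply/negligibleP; first exact: measurableI.
by apply: contrapT => h; apply: nk; exists k.
Qed.

Lemma nuclear_nonatomic (B : set X) : A B -> nonatomic mu A B ->
  let Eu := cond_exp mu A (fun x => (normc (u x) `^ p')%:E) in
  let Ew := cond_exp mu A (fun x => (normc (w x) `^ q)%:E) in
  {ae mu, forall x, B x -> (Eu x `^ p'^-1 * Ew x `^ q^-1 = 0)%E}.
Proof.
move=> AB B_na Eu Ew.
have AI F G : A F -> A G -> A (F `&` G).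
  by rewrite -!(measurable_subE sA) => ? ?; exact: measurableI.
have mup : measurable_fun setT (fun x => (normc (u x) `^ p')%:E) by exact: measurable_normcX.
have mwq : measurable_fun setT (fun x => (normc (w x) `^ q)%:E) by exact: measurable_normcX.
have fup x : (0 <= (normc (u x) `^ p')%:E < +oo)%E by rewrite lee_fin powR_ge0 ltry.
have fwq x : (0 <= (normc (w x) `^ q)%:E < +oo)%E by rewrite lee_fin powR_ge0 ltry.
have ftr n x : (0 <= (trunc_weight u p' n x)%:E < +oo)%E.
  by rewrite lee_fin trunc_weight_ge0 ltry.
have Eu0 x : (0 <= Eu x)%E by exact: (cond_exp_ge0 sA A_sub sf).
have Ew0 x : (0 <= Ew x)%E by exact: (cond_exp_ge0 sA A_sub sf).
have A_gt (h : X -> \bar R) : measurable_fun [set: g_sigma_algebraType A] h ->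
    A [set x | (0 < h x)%E].
  move=> mh; rewrite -(measurable_subE sA) -[X in measurable X]setTI.
  exact: emeasurable_fun_o_infty.
have A_ge (h : X -> \bar R) (k : nat) : measurable_fun [set: g_sigma_algebraType A] h ->
    A [set x | ((k.+1%:R^-1)%:E <= h x)%E].
  move=> mh; rewrite -(measurable_subE sA) -[X in measurable X]setTI.
  exact: emeasurable_fun_c_infty.
have gt0_bigcup (h : X -> \bar R) :
    [set x | (0 < h x)%E] `<=` \bigcup_k [set x | ((k.+1%:R^-1)%:E <= h x)%E].
  move=> x /=; case hx : (h x) => [y| |]//; last by exists 0%N => //=; rewrite hx leey.
  rewrite lte_fin => y0; exists (Num.truncn y^-1) => //=.
  rewrite hx lee_fin -[leRHS]invrK lef_pV2 ?posrE ?invr_gt0//.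
  exact/ltW/archimedean.Num.Theory.truncnS_gt.
have mEu : measurable_fun [set: g_sigma_algebraType A] Eu
  by exact: (measurable_cond_exp_sub sA A_sub sf).
have mEw : measurable_fun [set: g_sigma_algebraType A] Ew
  by exact: (measurable_cond_exp_sub sA A_sub sf).
pose Z := B `&` ([set x | (0 < Eu x)%E] `&` [set x | (0 < Ew x)%E]).
have AZ : A Z by apply: (AI _ _) => //; apply: (AI _ _); exact: A_gt.
have mZ := A_sub AZ.
suff /ae_notin : mu Z = 0%E.
  move=> /(_ mZ); apply: filterS => x Zx Bx.
  have [->|Eun] := eqVneq (Eu x) 0%E.
    by rewrite poweR0r ?mul0e// lt0r_neq0.
  have [->|Ewn] := eqVneq (Ew x) 0%E.
    by rewrite [X in (_ * X)%E]poweR0r ?mule0// lt0r_neq0// invr_gt0.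
  exfalso; apply: Zx; split => //; split.
    by rewrite /= lt_neqAle eq_sym Eun Eu0.
  by rewrite /= lt_neqAle eq_sym Ewn Ew0.
apply: contrapT => Zn0.
(* The test functions involve the truncated weight only, so a level [n] is fixed at which its
   integral over the bad set [Z] is not 0. *)
have [n Vn] : exists n, V n%:R Z <> 0%E.
  apply: contrapT => nV; apply: Zn0.
  have UZ : U Z = 0%E.
    rewrite -(cvg_lim _ (trunc_weight_cvg mZ))//; apply: lim_near_cst => //.
    by apply: nearW => n; apply: contrapT => Vn; apply: nV; exists n.
  have : {ae mu, forall x, Z x -> (normc (u x) `^ p')%:E = 0%E}.
    apply/ge0_integral_eq0 => //; first exact: measurable_funTS.
    by move=> x; case/andP: (fup x).
  move/(cond_exp_eq0 sA A_sub sf mup fup AZ) => Eu_0; apply/ae_notin => //.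
  apply: filterS Eu_0 => x Eux Zx; have e := Eux Zx.
  by case: Zx => _ [/= h _]; move: h; rewrite [Eu x]e ltxx.
have mtr : measurable_fun setT (fun x => (trunc_weight u p' n%:R x)%:E) by exact: mV.
pose g := cond_exp mu A (fun x => (trunc_weight u p' n%:R x)%:E).
have mg : measurable_fun [set: g_sigma_algebraType A] g.
  by exact: (measurable_cond_exp_sub sA A_sub sf).
have g0 x : (0 <= g x)%E by exact: (cond_exp_ge0 sA A_sub sf mtr (ftr n%:R)).
have Vg F : A F -> V n%:R F = (\int[mu]_(x in F) g x)%E.
  by move=> AF; rewrite /V (integral_cond_exp sA A_sub sf mtr (ftr n%:R) AF).
pose Z1 := Z `&` [set x | (0 < g x)%E].
have AZ1 : A Z1 by apply: (AI _ _) => //; exact: A_gt.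
have Z1n0 : mu Z1 <> 0%E.
  move=> Z10; apply: Vn; rewrite Vg//; apply/ge0_integral_eq0 => //.
    exact/measurable_funTS/(measurable_cond_exp sA A_sub sf mtr (ftr n%:R)).
  move/ae_notin : Z10 => /(_ (A_sub AZ1)); apply: filterS => x nZ1 Zx.
  apply/eqP; apply: contrapT => /negP gx; apply: nZ1; split => //=.
  by rewrite lt_neqAle eq_sym gx g0.
(* Three countable covers shrink the set without making it null: [g] is bounded below, then [Ew],
   and then the measure is finite. *)
have [k1 Z2n0] : exists k, mu (Z1 `&` [set x | ((k.+1%:R^-1)%:E <= g x)%E]) <> 0%E.
  apply: bigcup_mu_neq0 => //; first exact: A_sub.
    by move=> k; apply: A_sub; exact: A_ge.
  by move=> x [_ gx]; exact: gt0_bigcup.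
set Z2 := _ `&` _ in Z2n0.
have AZ2 : A Z2 by apply: (AI _ _) => //; exact: A_ge.
have [k2 Z3n0] : exists k, mu (Z2 `&` [set x | ((k.+1%:R^-1)%:E <= Ew x)%E]) <> 0%E.
  apply: bigcup_mu_neq0 => //; first exact: A_sub.
    by move=> k; apply: A_sub; exact: A_ge.
  by move=> x [[[_ [_ Ewx]] _] _]; exact: gt0_bigcup.
set Z3 := _ `&` _ in Z3n0.
have AZ3 : A Z3 by apply: (AI _ _) => //; exact: A_ge.
have [S ST /all_and2[mS Soo]] := sf.
have AS i : A (S i) by rewrite -(measurable_subE sA).
have [k3 Cn0] : exists k, mu (Z3 `&` S k) <> 0%E.
  apply: bigcup_mu_neq0 => //; first exact: A_sub.
    by move=> k; exact: A_sub.
  by rewrite -ST.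
set C := _ `&` _ in Cn0.
have AC : A C by exact: AI.
have mC := A_sub AC.
have Coo : (mu C < +oo)%E.
  apply: le_lt_trans (Soo k3); have mSk := A_sub (AS k3).
  by apply: (@le_measure _ _ _ mu C (S k3)); rewrite ?inE//; exact: subIsetr.
have C0 : (0 < mu C)%E by rewrite lt_neqAle measure_ge0 andbT eq_sym; exact/eqP.
have CB : C `<=` B by move=> x [[[[[]]]]].
pose de : R := k1.+1%:R^-1; pose de2 : R := k2.+1%:R^-1.
have de_gt0 : 0 < de by rewrite invr_gt0.
have de2_gt0 : 0 < de2 by rewrite invr_gt0.
have VC F : A F -> F `<=` C -> (de%:E * mu F <= V n%:R F)%E.
  move=> AF FC; have mF := A_sub AF; rewrite Vg// -integral_cst//.
  apply: ge0_le_integral => //.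
  - by move=> x _; rewrite lee_fin ltW.
  - exact/measurable_funTS/(measurable_cond_exp sA A_sub sf mtr (ftr n%:R)).
  - by move=> x /FC[[[_]]].
have WC F : A F -> F `<=` C -> (de2%:E * mu F <= W F)%E.
  move=> AF FC; have mF := A_sub AF.
  rewrite /W -(integral_cond_exp sA A_sub sf mwq fwq AF) -integral_cst//.
  apply: (ge0_le_integral _ mF).
  - by move=> x _; rewrite lee_fin ltW.
  - exact: measurable_cst.
  - exact/measurable_funTS/(measurable_cond_exp sA A_sub sf mwq fwq).
  - by move=> x /FC[[_]].
have [N NP] := nuclear_WCE_bound.
(* n^p' bounds the truncated weight; adding 1 makes [K] positive by construction. *)
pose K : R := n%:R `^ p' + 1.
have K0 : 0 < K by rewrite ltr_wpDl// powR_ge0.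
(* Chosen so that a part of measure m contributes at least c m^th to [nuclear_WCE_bound]. *)
pose c := de / 2 * K `^ (- p^-1) * de2 `^ q^-1.
have c0 : 0 < c.
  apply: mulr_gt0; last exact: powR_gt0.
  by apply: mulr_gt0; [exact: divr_gt0|exact: powR_gt0].
have fC0 : 0 < fine (mu C) by rewrite fine_gt0// C0.
have main e : 0 < e -> c * e `^ (th - 1) * fine (mu C) <= N *+ 2.
  move=> e0.
  have [|k [D [tD ADC De CD]]] := nonatomic_partition sA A_sub B_na AC CB _ e0.
    by rewrite C0.
  have AD i : A (D i) by have [] := ADC i.
  have DC i : D i `<=` C by have [] := ADC i.
  have Doo i : (mu (D i) < +oo)%E by apply: le_lt_trans (De i) _; rewrite ltry.
  pose m i := fine (mu (D i)).
  have m0 i : 0 <= m i by exact: fine_ge0.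
  have mE i : (m i)%:E = mu (D i) by rewrite fineK// ge0_fin_numE.
  (* The upper bound v <= K m serves under the negative power -1/p, the lower bound W >= de2 m under
     the power 1/q. *)
  have term i : ((c * (e `^ (th - 1) * m i))%:E <=
      (de / 2 * v n%:R (D i) `^ (- p^-1))%:E * W (D i) `^ q^-1)%E.
    have rhs0 : (0 <= (de / 2 * v n%:R (D i) `^ (- p^-1))%:E * W (D i) `^ q^-1)%E.
      by rewrite mule_ge0 ?poweR_ge0// lee_fin mulr_ge0 ?powR_ge0// divr_ge0// ltW.
    have [mi0|mi_neq0] := eqVneq (m i) 0; first by rewrite mi0 !mulr0.
    have mi_gt0 : 0 < m i by rewrite lt_neqAle eq_sym mi_neq0 m0.
    have mi_e : m i <= e by rewrite -lee_fin mE.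
    have vK : v n%:R (D i) <= K * m i.
      rewrite -lee_fin vE//.
      apply: le_trans (trunc_weight_integral_le A_sub u_meas pp' p_gt1 _ (AD i) (Doo i)) _.
      by rewrite -mE -EFinM lee_fin ler_wpM2r// lerDl.
    have v_gt0 : 0 < v n%:R (D i).
      apply: (@lt_le_trans _ _ (de * m i)); first exact: mulr_gt0.
      by rewrite -lee_fin vE// EFinM mE; apply: VC.
    have Wm : (((de2 * m i) `^ q^-1)%:E <= W (D i) `^ q^-1)%E.
      rewrite -poweR_EFin; apply: gt0_ler_poweR; rewrite ?invr_ge0 ?(ltW q0)//.
      + by rewrite in_itv/= leey andbT lee_fin mulr_ge0// ltW.
      + by rewrite in_itv/= leey andbT.
      + by rewrite EFinM mE; apply: WC.
    apply: le_trans (lee_wpmul2l _ Wm); last first.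
      by rewrite lee_fin mulr_ge0 ?powR_ge0// divr_ge0// ltW.
    rewrite -EFinM lee_fin.
    apply: (@le_trans _ _ (c * m i `^ th)).
      by rewrite ler_wpM2l ?(ltW c0)// mulrC powR_small.
    have -> : c * m i `^ th = de / 2 * (K * m i) `^ (- p^-1) * (de2 * m i) `^ q^-1.
      rewrite /c !powRM ?(ltW K0) ?(ltW de2_gt0)//.
      have -> : m i `^ th = m i `^ (- p^-1) * m i `^ q^-1.
        by rewrite -powRD ?mi_neq0 ?implybT// addrC.
      ring.
    rewrite ler_wpM2r ?powR_ge0// ler_wpM2l ?divr_ge0 ?(ltW de_gt0)//.
    rewrite !powRN lef_pV2 ?posrE ?powR_gt0 ?mulr_gt0//.
    by apply: ge0_ler_powR => //;
      rewrite ?nnegrE ?invr_ge0 ?mulr_ge0 ?(ltW p0) ?(ltW v_gt0) ?(ltW K0).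
  have := NP k D (fun=> de) n%:R tD AD Doo (fun=> ltW de_gt0).
  move=> /(_ (fun i F AF FD => VC F AF (subset_trans FD (DC i)))) h.
  have : (\sum_(i < k) (c * (e `^ (th - 1) * m i))%:E <= N%:E)%E.
    by apply: le_trans h; apply: lee_sum => i _; exact: term.
  rewrite sumEFin lee_fin -mulr_sumr -mulr_sumr => {}h.
  have {}CD : fine (mu C) <= (\sum_(i < k) m i) *+ 2.
    rewrite -lee_fin fineK ?ge0_fin_numE//; apply: le_trans CD _.
    by rewrite EFin_natmul -sumEFin !mule2n; under [in leRHS]eq_bigr do rewrite mE.
  apply: (@le_trans _ _ (c * e `^ (th - 1) * ((\sum_(i < k) m i) *+ 2))).
    by rewrite ler_wpM2l// mulr_ge0 ?powR_ge0// ltW.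
  by rewrite mulrnAr lerMn2r/= -mulrA.
(* Taking e with e^(th-1) = y turns [main] into 2|N| + 1 <= 2N. *)
pose y := (`|N| *+ 2 + 1) / (c * fine (mu C)).
have y0 : 0 < y.
  by apply: divr_gt0; [rewrite ltr_wpDl// mulrn_wge0|exact: mulr_gt0].
have := main (y `^ (th - 1)^-1) (powR_gt0 _ y0).
rewrite -powRrM mulVf ?(ltr0_neq0 th1)// powRr1 ?(ltW y0)//.
rewrite mulrAC /y mulrC divfK ?(gt_eqF (mulr_gt0 c0 fC0))//.
by have := ler_norm N; rewrite !mulr2n; lra.
Qed.

End forward.

(** * Sufficiency *)

Lemma Re_le_normc {R : realType} (z : R[i]) : `|complex.Re z| <= normc z.
Proof. by rewrite normcE_sqrt -sqrtr_sqr ler_wsqrtr// lerDl sqr_ge0. Qed.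

Lemma Im_le_normc {R : realType} (z : R[i]) : `|complex.Im z| <= normc z.
Proof. by rewrite normcE_sqrt -sqrtr_sqr ler_wsqrtr// lerDr sqr_ge0. Qed.

Lemma normc_le_ReIm {R : realType} (z : R[i]) :
  normc z <= `|complex.Re z| + `|complex.Im z|.
Proof.
rewrite normcE_sqrt -(@ler_pXn2r _ 2) ?nnegrE ?sqrtr_ge0 ?addr_ge0//.
rewrite sqr_sqrtr ?addr_ge0 ?sqr_ge0// sqrrD !real_normK ?num_real//.
by rewrite lerD2r lerDl mulrn_wge0 ?mulr_ge0.
Qed.

Section ccond_exp_sets.
Context d (X : measurableType d) (R : realType).
Variables (mu : {measure set X -> \bar R}) (A : set (set X)).
Hypotheses (sA : sigma_algebra [set: X] A) (A_sub : A `<=` measurable).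
Hypothesis sf : sigma_finite [set: g_sigma_algebraType A] mu.
Variables (h : X -> R[i]) (mh : cmeasurable h).

Let mRp : measurable_fun setT (EFin \o (fun y => complex.Re (h y)))^\+%E.
Proof. by apply: measurable_funepos; apply/measurable_EFinP; case: mh. Qed.
Let mRn : measurable_fun setT (EFin \o (fun y => complex.Re (h y)))^\-%E.
Proof. by apply: measurable_funeneg; apply/measurable_EFinP; case: mh. Qed.
Let mIp : measurable_fun setT (EFin \o (fun y => complex.Im (h y)))^\+%E.
Proof. by apply: measurable_funepos; apply/measurable_EFinP; case: mh. Qed.
Let mIn : measurable_fun setT (EFin \o (fun y => complex.Im (h y)))^\-%E.
Proof. by apply: measurable_funeneg; apply/measurable_EFinP; case: mh. Qed.

Lemma ccond_exp_eq0 D : A D -> {ae mu, forall x, D x -> h x = 0} ->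
  {ae mu, forall x, D x -> ccond_exp mu A h x = 0}.
Proof.
move=> AD h0.
have /(cond_exp_eq0 sA A_sub sf mRp (funepos_fin _) AD) eRp : {ae mu, forall x, D x ->
    (EFin \o (fun y => complex.Re (h y)))^\+%E x = 0%E}.
  by apply: filterS h0 => x + Dx => /(_ Dx) hx; rewrite funeposE/= hx maxxx.
have /(cond_exp_eq0 sA A_sub sf mRn (funeneg_fin _) AD) eRn : {ae mu, forall x, D x ->
    (EFin \o (fun y => complex.Re (h y)))^\-%E x = 0%E}.
  by apply: filterS h0 => x + Dx => /(_ Dx) hx; rewrite funenegE/= hx oppr0 maxxx.
have /(cond_exp_eq0 sA A_sub sf mIp (funepos_fin _) AD) eIp : {ae mu, forall x, D x ->
    (EFin \o (fun y => complex.Im (h y)))^\+%E x = 0%E}.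
  by apply: filterS h0 => x + Dx => /(_ Dx) hx; rewrite funeposE/= hx maxxx.
have /(cond_exp_eq0 sA A_sub sf mIn (funeneg_fin _) AD) eIn : {ae mu, forall x, D x ->
    (EFin \o (fun y => complex.Im (h y)))^\-%E x = 0%E}.
  by apply: filterS h0 => x + Dx => /(_ Dx) hx; rewrite funenegE/= hx oppr0 maxxx.
apply: (filter_app _ _ eRp); apply: (filter_app _ _ eRn).
apply: (filter_app _ _ eIp); apply: (filter_app _ _ eIn).
apply: aeW => x eIn' eIp' eRn' eRp' Dx.
by rewrite /ccond_exp /rcond_exp eIn'// eIp'// eRn'// eRp'// subrr.
Qed.

(** The positive and negative parts of Re h and Im h have conditional expectations equal on [F] to
    their means, which lie between 0 and the mean of |h|. Hence both coordinates of [c] are at most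
    that mean in modulus; their sum gives the factor 2. *)
Lemma ccond_exp_atom F : atom mu A F -> (\int[mu]_(x in F) (normc (h x))%:E < +oo)%E ->
  exists2 c : R[i], {ae mu, forall x, F x -> ccond_exp mu A h x = c} &
    normc c <= 2 * (fine (\int[mu]_(x in F) (normc (h x))%:E) / fine (mu F)).
Proof.
move=> aF hoo; have AF : A F by case: aF.
have mF := A_sub AF; have F_gt0 := fine_atom_gt0 sA A_sub sf aF.
set J := (\int[mu]_(x in F) _)%E in hoo *.
have mJ : measurable_fun F (fun x => (normc (h x))%:E).
  exact/measurable_EFinP/measurable_funTS/measurable_normc.
pose c (f : X -> \bar R) := fine (\int[mu]_(x in F) f x * ((fine (mu F))^-1)%:E)%E.
have cP (f : X -> \bar R) : measurable_fun setT f -> (forall x, 0 <= f x < +oo)%E ->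
    (forall x, f x <= (normc (h x))%:E)%E ->
    {ae mu, forall x, F x -> fine (cond_exp mu A f x) = c f} /\
    0 <= c f <= fine J / fine (mu F).
  move=> mf f0 fh; split.
    have := atom_constant sA A_sub sf aF (measurable_cond_exp_sub sA A_sub sf mf f0)
      (cond_exp_ge0 sA A_sub sf mf f0).
    apply: filterS => x + Fx => /(_ Fx) ->.
    by rewrite (integral_cond_exp sA A_sub sf mf f0 AF).
  have fJ : (\int[mu]_(x in F) f x <= J)%E.
    apply: (ge0_le_integral _ mF) => //.
    - by move=> x _; case/andP: (f0 x).
    - exact: measurable_funTS.
  have f_ge0 : (0 <= \int[mu]_(x in F) f x)%E.
    by apply: integral_ge0 => x _; case/andP: (f0 x).
  have f_fin : (\int[mu]_(x in F) f x)%E \is a fin_num.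
    by rewrite ge0_fin_numE//; exact: le_lt_trans hoo.
  rewrite /c fineM//= divr_ge0 ?fine_ge0 ?(ltW F_gt0)//=.
  rewrite ler_wpM2r ?invr_ge0 ?(ltW F_gt0)// fine_le// ge0_fin_numE//.
  exact: le_trans fJ.
have pos_le (g : X -> R) : (forall x, `|g x| <= normc (h x)) ->
    forall x, ((EFin \o g)^\+ x <= (normc (h x))%:E)%E.
  move=> gh x; rewrite funeposE/= -EFin_max lee_fin ge_max normc_ge0 andbT.
  exact: le_trans (ler_norm _) (gh x).
have neg_le (g : X -> R) : (forall x, `|g x| <= normc (h x)) ->
    forall x, ((EFin \o g)^\- x <= (normc (h x))%:E)%E.
  move=> gh x; rewrite funenegE/= -EFin_max lee_fin ge_max normc_ge0 andbT.
  by apply: le_trans (ler_norm _) _; rewrite normrN.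
have [eRp /andP[Rp0 RpJ]] := cP _ mRp (funepos_fin _) (pos_le _ (fun x => Re_le_normc (h x))).
have [eRn /andP[Rn0 RnJ]] := cP _ mRn (funeneg_fin _) (neg_le _ (fun x => Re_le_normc (h x))).
have [eIp /andP[Ip0 IpJ]] := cP _ mIp (funepos_fin _) (pos_le _ (fun x => Im_le_normc (h x))).
have [eIn /andP[In0 InJ]] := cP _ mIn (funeneg_fin _) (neg_le _ (fun x => Im_le_normc (h x))).
exists ((c (EFin \o (fun y => complex.Re (h y)))^\+%E
    - c (EFin \o (fun y => complex.Re (h y)))^\-%E)
  +i* (c (EFin \o (fun y => complex.Im (h y)))^\+%E
    - c (EFin \o (fun y => complex.Im (h y)))^\-%E)).
  apply: (filter_app _ _ eRp); apply: (filter_app _ _ eRn).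
  apply: (filter_app _ _ eIp); apply: (filter_app _ _ eIn).
  apply: aeW => x eIn' eIp' eRn' eRp' Fx.
  by rewrite /ccond_exp /rcond_exp eIn'// eIp'// eRn'// eRp'.
apply: le_trans (normc_le_ReIm _) _.
rewrite mulr_natl mulr2n /=.
have dist_le (a b k : R) : 0 <= a -> a <= k -> 0 <= b -> b <= k -> `|a - b| <= k.
  by move=> a0 ak b0 bk; rewrite ler_norml; apply/andP; split; lra.
by apply: lerD; exact: dist_le.
Qed.

End ccond_exp_sets.

Section atom_term.
Context d (X : measurableType d) (R : realType).
Variables (mu : {measure set X -> \bar R}) (A : set (set X)).
Hypotheses (sA : sigma_algebra [set: X] A) (A_sub : A `<=` measurable).
Hypothesis sf : sigma_finite [set: g_sigma_algebraType A] mu.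
Variables (p q p' r : R).
Hypotheses (pp' : p^-1 + p'^-1 = 1) (pqr : p^-1 + r^-1 = q^-1).
Variables (f g : X -> R).
Hypotheses (mf : measurable_fun setT f) (mg : measurable_fun setT g).
Hypotheses (f0 : forall x, 0 <= f x) (g0 : forall x, 0 <= g x).

(** The values on [F] are means over [F], and the powers of mu(F) combine as 1/r - 1/p' - 1/q = -1.
    It is used with f = |u|^p' and g = |w|^q. *)
Lemma atom_termE F : atom mu A F ->
  (atom_value mu (cond_exp mu A (EFin \o f)) F `^ p'^-1 *
   atom_value mu (cond_exp mu A (EFin \o g)) F `^ q^-1 * mu F `^ r^-1 =
   ((fine (mu F))^-1)%:E * ((\int[mu]_(x in F) (f x)%:E) `^ p'^-1 *
    (\int[mu]_(x in F) (g x)%:E) `^ q^-1))%E.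
Proof.
move=> aF; have AF : A F by case: aF.
have F_gt0 := fine_atom_gt0 sA A_sub sf aF.
have h (k : X -> R) : measurable_fun setT k -> (forall x, 0 <= k x) ->
    (atom_value mu (cond_exp mu A (EFin \o k)) F =
     \int[mu]_(x in F) (k x)%:E * ((fine (mu F))^-1)%:E)%E.
  move=> /measurable_EFinP mk k0.
  have k0oo x : (0 <= (EFin \o k) x < +oo)%E by rewrite /= lee_fin k0 ltry.
  rewrite (atom_valueE sA A_sub sf aF (measurable_cond_exp_sub sA A_sub sf mk k0oo)
    (cond_exp_ge0 sA A_sub sf mk k0oo)).
  by rewrite (integral_cond_exp sA A_sub sf mk k0oo AF).
have i0 (k : X -> R) : (forall x, 0 <= k x) -> (0 <= \int[mu]_(x in F) (k x)%:E)%E.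
  by move=> k0; apply: integral_ge0 => x _; rewrite lee_fin.
rewrite !h// -(fine_atomK sA A_sub sf aF) !poweRM ?i0 ?lee_fin ?invr_ge0 ?(ltW F_gt0)//.
rewrite !poweR_EFin.
have e : (fine (mu F))^-1 = (fine (mu F))^-1 `^ p'^-1 * (fine (mu F))^-1 `^ q^-1 *
    fine (mu F) `^ r^-1.
  have inv_powR (a : R) : (fine (mu F))^-1 `^ a = fine (mu F) `^ (- a).
    by rewrite -powR_inv1 ?(ltW F_gt0)// -powRrM mulN1r.
  rewrite !inv_powR -!powRD ?(gt_eqF F_gt0) ?implybT//.
  rewrite -[LHS]powR_inv1 ?(ltW F_gt0)//.
  by congr (_ `^ _); rewrite -pqr -pp'; ring.
rewrite [in RHS]e !EFinM.
by rewrite /= muleACA [RHS]muleC [RHS]muleA.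
Qed.

End atom_term.

(** * Restrictions to the sets of a countable partition *)

Section restr_sets.
Context d {X : measurableType d} {R : realType}.
Variables (mu : {measure set X -> \bar R}) (p : R) (p1 : 1 <= p).
Implicit Types (C D : set X) (F G : cLspace mu p1).

Let p0 : 0 < p. Proof. exact: lt_le_trans ltr01 p1. Qed.

(** [restr] carries a proof of measurability, so replacing the set by an equal one takes proof
    irrelevance. *)
Lemma eq_restr C D (mC : measurable C) (mD : measurable D) F : C = D ->
  restr mC F = restr mD F.
Proof. by move=> CD; subst D; rewrite (Prop_irrelevance mC mD). Qed.

Lemma restrU C D (mC : measurable C) (mD : measurable D)
    (mCD : measurable (C `|` D)) F : C `&` D = set0 ->
  restr mCD F = restr mC F + restr mD F.
Proof.
move=> CD0; apply: cLspace_ext.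
apply: filter_app (restr_fun mCD F); apply: filter_app (restr_fun mC F).
apply: filter_app (restr_fun mD F); apply: filter_app (cLspace_funD (restr mC F) (restr mD F)).
apply: aeW => x eDF eD eC eCD; apply: (etrans eCD).
apply: etrans _ (esym (etrans eDF (congr2 +%R eC eD))); rewrite /cut in_setU.
case: (boolP (x \in C)) => xC; last by rewrite add0r.
rewrite memNset ?addr0// => xD; suff : (C `&` D) x by rewrite CD0.
by split => //; rewrite -in_setE.
Qed.

Lemma restrT (mT : measurable [set: X]) F : restr mT F = F.
Proof.
apply: cLspace_ext; apply: filterS (restr_fun mT F) => x ->.
by rewrite /cut mem_set.
Qed.

Lemma restr_eq0 C (mC : measurable C) F :
  {ae mu, forall x, C x -> cLspace_fun F x = 0} -> restr mC F = 0.
Proof.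
move=> F0; rewrite -[RHS](scale0r F); apply: cLspace_ext.
apply: filter_app (restr_fun mC F); apply: filter_app (cLspace_funZ 0 F).
apply: (filter_app _ _ F0); apply: aeW => x Cx eZ eC; apply: (etrans eC).
apply: etrans _ (esym eZ); rewrite mul0r /cut.
by case: ifPn => //; rewrite inE => /Cx.
Qed.

Variables (C : nat -> set X) (B : set X).
Hypotheses (mC : forall i, measurable (C i)) (tC : trivIset setT C).
Hypothesis CB : \bigcup_i C i `|` B = setT.

Let D n := \big[setU/set0]_(i < n) C i.
Let mD n : measurable (D n). Proof. exact: bigsetU_measurable. Qed.
Let mDc n : measurable (~` D n). Proof. exact: measurableC. Qed.

Lemma sum_restr n F : \sum_(0 <= i < n) restr (mC i) F = restr (mD n) F.
Proof.
elim: n => [|n IH].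
  rewrite big_geq//; apply/esym/restr_eq0; apply: aeW => x.
  by rewrite /D big_ord0.
have DE : D n.+1 = D n `|` C n by rewrite /D big_ord_recr.
have mU : measurable (D n `|` C n) by exact: measurableU.
have DC0 : D n `&` C n = set0.
  by apply: (@trivIset_bigsetUI _ predT) => //; exact: sub_trivIset tC.
rewrite big_nat_recr; last by [].
apply: etrans (congr1 (+%R^~ (restr (mC n) F)) IH) _.
apply: etrans (esym (restrU (mD n) (mC n) mU F DC0)) _.
exact: eq_restr (esym DE).
Qed.

(** The remainder is the restriction of [F] to the complement of [D n]. Its p-th powers tend to 0
    almost everywhere and are dominated by |F|^p. *)
Lemma restr_series_cvg F : {ae mu, forall x, B x -> cLspace_fun F x = 0} ->
  series (fun i => restr (mC i) F) @ \oo --> F.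
Proof.
move=> FB; apply/cvgrPdist_lt => e e0.
have [a aE] : exists a : R, e = a%:C.
  by exists (complex.Re e); rewrite RRe_real// ger0_real// ltW.
move: e0; rewrite aE ltcR => a0.
have subE n : F - series (fun i => restr (mC i) F) n = restr (mDc n) F.
  rewrite /series/= sum_restr; apply/eqP; rewrite subr_eq; apply/eqP.
  rewrite -{1}(restrT measurableT F).
  have TE : [set: X] = ~` D n `|` D n by rewrite setUC setUv.
  have mU : measurable (~` D n `|` D n) by exact: measurableU.
  by rewrite (eq_restr measurableT mU F TE) restrU// setICl.
pose f x := (normc (cLspace_fun F x) `^ p)%:E.
have mf : measurable_fun setT f by apply: measurable_normcX; exact: cmeasurable_cLspace.
have f0 x : (0 <= f x)%E by rewrite lee_fin powR_ge0.
have if_ : mu.-integrable setT f.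
  apply/integrableP; split => //; under eq_integral do rewrite gee0_abs//.
  exact: (cLfun_integral_ltey (repr F)).
have : (\int[mu]_x ((f \_ (~` D n)) x))%E @[n --> \oo] --> (\int[mu]_x (cst 0 x))%E.
  have [] := @dominated_convergence _ _ _ mu setT measurableT
     (fun n => f \_ (~` D n)) (cst 0%E) f _ _ _ if_ _ => //.
  - by move=> n; apply/(measurable_restrictT _ (mDc n)); exact: measurable_funTS.
  - apply: filterS FB => x FBx _; apply: cvg_near_cst.
    have : [set: X] x by [].
    rewrite -CB => -[[i _ Cix]|Bx]; last first.
      apply: nearW => n; rewrite patchE; case: ifPn => // _.
      by rewrite /f FBx// ComplexField.Normc.normc0 powR0 ?gt_eqF.
    exists i.+1 => // n /= ni; rewrite patchE memNset//=; apply.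
    by rewrite /D -bigcup_mkord; exists i.
  - apply: aeW => x n _; rewrite patchE; case: ifPn => _.
      by rewrite gee0_abs.
    by rewrite abse0.
rewrite integral_cst// mul0e => /fine_cvgP[_] /cvgrPdist_lt/(_ (a `^ p)).
move=> /(_ (powR_gt0 _ a0)); apply: filterS => n; rewrite sub0r normrN /=.
rewrite -integral_mkcond -(rnorm_restr (mDc n) F) /= ger0_norm ?powR_ge0// => ha.
rewrite subE normr_rnorm ltcR ltNge; apply: contraTN ha => ha; rewrite -leNgt.
by apply: ge0_ler_powR; rewrite ?nnegrE ?rnorm_ge0 ?(ltW a0) ?(ltW p0).
Qed.

End restr_sets.

(** Since z is nonzero the coefficient is unique, and uniqueness makes any choice of it linear. *)
Lemma linear_coefficient {R : realType} {Y Z : normedModType R[i]}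
    (S : {linear Y -> Z}) (z : Z) : z != 0 -> (forall y, exists c, S y = c *: z) ->
  exists phi : {linear Y -> R[i]^o}, forall y, S y = (phi y : R[i]) *: z.
Proof.
move=> z0 /choice[c cE].
have c_lin : linear (c : Y -> R[i]^o).
  move=> a x y; apply/eqP; rewrite -subr_eq0.
  suff /eqP : (c (a *: x + y) - (a * c x + c y)) *: z = 0.
    by rewrite scaler_eq0 (negPf z0) orbF.
  by rewrite scalerBl scalerDl -scalerA -!cE linearP subrr.
pose phi : {linear Y -> R[i]^o} := HB.pack (c : Y -> R[i]^o)
  (GRing.isLinear.Build _ _ _ _ (c : Y -> R[i]^o) c_lin).
by exists phi.
Qed.

Section backward.
Context d (X : measurableType d) (R : realType).
Variables (mu : {measure set X -> \bar R}) (A : set (set X)).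
Hypotheses (sA : sigma_algebra [set: X] A) (A_sub : A `<=` measurable).
Hypothesis sf : sigma_finite [set: g_sigma_algebraType A] mu.
Variables (p q p' : R) (p1 : 1 <= p) (q1 : 1 <= q) (p_gt1 : 1 < p).
Hypotheses (pp' : p^-1 + p'^-1 = 1).
Variables (w u : X -> R[i]) (w_meas : cmeasurable w) (u_meas : cmeasurable u).
Variable T : {linear cLspace mu p1 -> cLspace mu q1}.
Hypothesis T_WCE : is_WCE A w u T.

Let p0 : 0 < p. Proof. exact: lt_trans p_gt1. Qed.
Let q0 : 0 < q. Proof. exact: lt_le_trans q1. Qed.
Let p'i0 : 0 < p'^-1.
Proof. by rewrite -(ltrD2l p^-1) pp' addr0 invf_lt1. Qed.
Let p'0 : 0 < p'. Proof. by rewrite -invr_gt0. Qed.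
Let p'1 : 1 <= p'.
Proof. by rewrite -invf_le1// -pp' lerDr invr_ge0 ltW. Qed.

Let W F := (\int[mu]_(x in F) (normc (w x) `^ q)%:E)%E.
Let U F := (\int[mu]_(x in F) (normc (u x) `^ p')%:E)%E.

Let U0 F : (0 <= U F)%E.
Proof. by apply: integral_ge0 => x _; rewrite lee_fin powR_ge0. Qed.

Let W0 F : (0 <= W F)%E.
Proof. by apply: integral_ge0 => x _; rewrite lee_fin powR_ge0. Qed.

Lemma integral_normcX_eq0 (f : X -> R[i]) (a : R) D : 0 < a -> measurable D -> cmeasurable f ->
  (\int[mu]_(x in D) (normc (f x) `^ a)%:E = 0)%E <-> {ae mu, forall x, D x -> f x = 0}.
Proof.
move=> a0 mD mf; rewrite ge0_integral_eq0//; last 2 first.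
- by apply: measurable_funTS; exact: measurable_normcX.
- by move=> x; rewrite lee_fin powR_ge0.
split; apply: filterS => x + Dx => /(_ Dx).
  move=> [/eqP]; rewrite powR_eq0 => /andP[/eqP fx _].
  exact: ComplexField.Normc.eq0_normc.
by move=> ->; rewrite ComplexField.Normc.normc0 powR0// gt_eqF.
Qed.

(** [D] is taken in [A] because conditional expectation is local only on the sets of [A]; for zeros
    of [w], which multiplies afterwards, any set will do. *)
Lemma WCE_eq0_u D F : A D -> {ae mu, forall x, D x -> u x = 0} ->
  {ae mu, forall x, D x -> cLspace_fun (T F) x = 0}.
Proof.
move=> AD u0; have [[mF _] TF] := T_WCE F.
have /(ccond_exp_eq0 sA A_sub sf mF AD) h :
    {ae mu, forall x, D x -> u x * cLspace_fun F x = 0}.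
  by apply: filterS u0 => x + Dx => /(_ Dx) ->; rewrite mul0r.
by apply: filterS2 TF h => x -> + Dx => /(_ Dx) ->; rewrite mulr0.
Qed.

Lemma WCE_eq0_w D F : {ae mu, forall x, D x -> w x = 0} ->
  {ae mu, forall x, D x -> cLspace_fun (T F) x = 0}.
Proof.
move=> w0; have [_ TF] := T_WCE F.
by apply: filterS2 TF w0 => x -> + Dx => /(_ Dx) ->; rewrite mul0r.
Qed.

Lemma hoelder_cLspace D (F : cLspace mu p1) : measurable D ->
  (\int[mu]_(x in D) (normc (u x * cLspace_fun F x))%:E <=
   U D `^ p'^-1 * (rnorm F)%:E)%E.
Proof.
move=> mD.
have mF := cmeasurable_cLspace F.
have := @hoelder _ _ _ mu (fun x => normc (cut D u x)) (fun x => normc (cLspace_fun F x)) p' p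
  (measurable_normc (cmeasurable_cut mD u_meas)) (measurable_normc mF) p'0 p0.
rewrite addrC pp' => /(_ erefl).
rewrite -[Lnorm _ p'%:E _]/(cLnorm mu p' (cut D u)) -[Lnorm _ p%:E _]/(cLnorm mu p (cLspace_fun F)).
rewrite !cLnormE integral_cut//.
rewrite -rnorm_cLspace poweR_EFin -powRrM mulfV ?gt_eqF// powRr1 ?rnorm_ge0//.
apply: le_trans.
rewrite Lnorm1 integral_mkcond; apply: ge0_le_integral => //.
- by move=> x _; rewrite patchE; case: ifPn => // _; rewrite lee_fin normc_ge0.
- apply/(measurable_restrictT _ mD)/measurable_funTS/measurable_EFinP.
  by apply: measurable_normc; exact: cmeasurableM.
- do 2 apply: measurableT_comp => //; apply: measurable_funM.
    by apply: measurable_normc; exact: cmeasurable_cut.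
  exact: measurable_normc.
move=> x _; rewrite patchE /= /cut; case: ifPn => _; last by rewrite -[point]/(0%E) lee_fin.
by rewrite lee_fin ComplexField.Normc.normcM ler_norm.
Qed.

Lemma atom_rank_one F (mF : measurable F) : atom mu A F ->
    let s := (((fine (mu F))^-1)%:E * (U F `^ p'^-1 * W F `^ q^-1))%E in
    (s < +oo)%E ->
  exists (phi : {linear cLspace mu p1 -> R[i]^o}) (z : cLspace mu q1),
    [/\ bounded_op phi, ((op_norm phi * rnorm z)%:E <= 2%:E * s)%E &
        forall f, restr mF (T f) = (phi f : R[i]) *: z].
Proof.
move=> aF s soo; have AF : A F by case: aF.
have F_gt0 := fine_atom_gt0 sA A_sub sf aF.
have s0 : (0 <= s)%E by rewrite !mule_ge0 ?poweR_ge0// lee_fin invr_ge0 ltW.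
(* Zero operator, for the case where u or w vanishes on [F]: then [s] is 0 even if the other
   integral is infinite. *)
have deg : (forall f, restr mF (T f) = 0) ->
  exists (phi : {linear cLspace mu p1 -> R[i]^o}) (z : cLspace mu q1),
    [/\ bounded_op phi, ((op_norm phi * rnorm z)%:E <= 2%:E * s)%E &
        forall f, restr mF (T f) = (phi f : R[i]) *: z].
  move=> Tf0; exists \0, 0; split.
  - by exists 0 => y; rewrite normr0 mul0r.
  - by rewrite rnorm0 mulr0 mule_ge0.
  - by move=> f; rewrite Tf0 scaler0.
have [UF0|UFn0] := eqVneq (U F) 0%E.
  apply: deg => f; apply: restr_eq0; apply: WCE_eq0_u => //.
  exact/(integral_normcX_eq0 p'0 mF u_meas).
have [WF0|WFn0] := eqVneq (W F) 0%E.
  apply: deg => f; apply: restr_eq0; apply: WCE_eq0_w => //.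
  exact/(integral_normcX_eq0 q0 mF w_meas).
have UFgt0 : (0 < U F)%E by rewrite lt_neqAle eq_sym UFn0 U0.
have WFgt0 : (0 < W F)%E by rewrite lt_neqAle eq_sym WFn0 W0.
(* Both integrals are now positive, so an infinite one would make [s] infinite. *)
have UFoo : (U F < +oo)%E.
  rewrite ltey; apply/eqP => UFy; move: soo; rewrite /s UFy poweRyr ?gt_eqF//.
  by rewrite (gt0_mulye (poweR_gt0 _ WFgt0)) gt0_muley ?ltxx// lte_fin invr_gt0.
have WFoo : (W F < +oo)%E.
  rewrite ltey; apply/eqP => WFy; move: soo; rewrite /s WFy poweRyr ?invr_neq0 ?gt_eqF//.
  by rewrite (gt0_muley (poweR_gt0 _ UFgt0)) gt0_muley ?ltxx// lte_fin invr_gt0.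
have [a UE] : exists a, U F = a%:E.
  by exists (fine (U F)); exact: esym (fineK (etrans (ge0_fin_numE (U0 F)) UFoo)).
have [c WE] : exists c, W F = c%:E.
  by exists (fine (W F)); exact: esym (fineK (etrans (ge0_fin_numE (W0 F)) WFoo)).
have zoo : (\int[mu]_x (normc (cut F w x) `^ q)%:E < +oo)%E by rewrite integral_cut.
pose z := cLclass (mk_cLfun q1 (cmeasurable_cut mF w_meas) zoo).
have zE : rnorm z = c `^ q^-1.
  rewrite -[LHS]powRr1 ?rnorm_ge0// -(mulfV (lt0r_neq0 q0)) powRrM; congr (_ `^ _).
  by apply: EFin_inj; rewrite rnorm_cLclass -WE; exact: integral_cut.
(* Hoelder's bound for the integral of |u f| over [F], divided by mu(F), with the factor 2 of
   [ccond_exp_atom]. *)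
pose b := 2 * (a `^ p'^-1 / fine (mu F)).
have rank f : exists2 e : R[i], restr mF (T f) = e *: z & normc e <= b * rnorm f.
  have [[mf _] Tf] := T_WCE f.
  have hf := hoelder_cLspace f mF.
  have hoo : (\int[mu]_(x in F) (normc (u x * cLspace_fun f x))%:E < +oo)%E.
    by apply: le_lt_trans hf _; rewrite UE poweR_EFin -EFinM ltry.
  have [e cE cb] := ccond_exp_atom sA A_sub sf mf aF hoo.
  exists e.
    apply: cLspace_ext; apply: (filter_app _ _ cE); apply: (filter_app _ _ Tf).
    apply: filter_app (restr_fun mF (T f)); apply: filter_app (cLspace_funZ e z).
    apply: filter_app (cLclassK (mk_cLfun q1 (cmeasurable_cut mF w_meas) zoo)).
    apply: aeW => x zx eZ eT Tfx cx; apply: (etrans eT).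
    apply: etrans _ (esym (etrans eZ (congr1 ( *%R e) zx))); rewrite /= /cut.
    by case: ifPn => [|_]; rewrite ?mulr0// inE => /cx <-; rewrite Tfx mulrC.
  apply: le_trans cb _; rewrite /b -!mulrA ler_wpM2l// [_^-1 * _]mulrC mulrA.
  rewrite ler_wpM2r ?invr_ge0 ?(ltW F_gt0)//.
  rewrite -lee_fin fineK; first by rewrite EFinM -poweR_EFin -UE.
  by rewrite ge0_fin_numE//; apply: integral_ge0 => x _; rewrite lee_fin normc_ge0.
have b0 : 0 <= b by rewrite mulr_ge0// divr_ge0 ?powR_ge0// ltW.
have z_gt0 : 0 < rnorm z by rewrite zE; apply: powR_gt0; rewrite -lte_fin -WE.
have z0 : z != 0 by apply: contraTneq z_gt0 => ->; rewrite rnorm0 ltxx.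
have [phi phiE] : exists phi : {linear cLspace mu p1 -> R[i]^o},
    forall f, restr mF (T f) = (phi f : R[i]) *: z.
  apply: (@linear_coefficient R _ _ (restr mF \o T) z z0) => f.
  by have [e eE _] := rank f; exists e; exact: eE.
have phi_b f : rnorm (phi f) <= b * rnorm f.
  rewrite rnorm_regular; have [e + eb] := rank f; rewrite phiE => /eqP.
  by rewrite -subr_eq0 -scalerBl scaler_eq0 (negPf z0) orbF subr_eq0 => /eqP ->.
exists phi, z; split => //.
- exists b => f; rewrite normr_rnorm [X in _ <= _ * X]normr_rnorm -rmorphM lecR.
  exact: phi_b.
- have -> : s = ((fine (mu F))^-1 * (a `^ p'^-1 * c `^ q^-1))%:E.
    by rewrite /s UE WE !poweR_EFin -!EFinM.
  rewrite -EFinM lee_fin zE.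
  apply: (@le_trans _ _ (b * c `^ q^-1)).
    by rewrite ler_wpM2r ?powR_ge0// op_norm_le.
  by rewrite /b -mulrA [_ / _]mulrC -[X in _ * X <= _]mulrA.
Qed.

End backward.

Section sufficiency.
Context d (X : measurableType d) (R : realType).
Variables (mu : {measure set X -> \bar R}) (A : set (set X)).
Hypotheses (sA : sigma_algebra [set: X] A) (A_sub : A `<=` measurable).
Hypothesis sf : sigma_finite [set: g_sigma_algebraType A] mu.
Variables (p q p' : R) (p1 : 1 <= p) (q1 : 1 <= q) (p_gt1 : 1 < p).
Hypotheses (pp' : p^-1 + p'^-1 = 1).
Variables (w u : X -> R[i]) (w_meas : cmeasurable w) (u_meas : cmeasurable u).
Variable T : {linear cLspace mu p1 -> cLspace mu q1}.
Hypothesis T_WCE : is_WCE A w u T.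

Let Eu := cond_exp mu A (fun x => (normc (u x) `^ p')%:E).
Let Ew := cond_exp mu A (fun x => (normc (w x) `^ q)%:E).

Let p0 : 0 < p. Proof. exact: lt_trans p_gt1. Qed.
Let q0 : 0 < q. Proof. exact: lt_le_trans q1. Qed.
Let p'i0 : 0 < p'^-1.
Proof. by rewrite -(ltrD2l p^-1) pp' addr0 invf_lt1. Qed.
Let p'0 : 0 < p'. Proof. by rewrite -invr_gt0. Qed.

(** Where the product vanishes, one of [Eu] and [Ew] does. Their zero sets in [B] belong to [A], so
    u vanishes almost everywhere on the first and w on the second. *)
Lemma WCE_eq0_cond_exp B : A B ->
    {ae mu, forall x, B x -> (Eu x `^ p'^-1 * Ew x `^ q^-1 = 0)%E} ->
  forall f, {ae mu, forall x, B x -> cLspace_fun (T f) x = 0}.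
Proof.
move=> AB EB f.
have AI F G : A F -> A G -> A (F `&` G).
  by rewrite -!(measurable_subE sA) => ? ?; exact: measurableI.
have mup : measurable_fun setT (fun x => (normc (u x) `^ p')%:E) by exact: measurable_normcX.
have mwq : measurable_fun setT (fun x => (normc (w x) `^ q)%:E) by exact: measurable_normcX.
have fup x : (0 <= (normc (u x) `^ p')%:E < +oo)%E by rewrite lee_fin powR_ge0 ltry.
have fwq x : (0 <= (normc (w x) `^ q)%:E < +oo)%E by rewrite lee_fin powR_ge0 ltry.
have Eu0 x : (0 <= Eu x)%E by exact: (cond_exp_ge0 sA A_sub sf mup fup).
have Ew0 x : (0 <= Ew x)%E by exact: (cond_exp_ge0 sA A_sub sf mwq fwq).
have A_eq0 (h : X -> \bar R) : measurable_fun [set: g_sigma_algebraType A] h ->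
    A (B `&` [set x | h x = 0%E]).
  move=> mh; apply: (AI _ _) => //; rewrite -(measurable_subE sA) -[X in measurable X]setTI.
  exact: (mh _ [set 0%E]).
have AZu := A_eq0 _ (measurable_cond_exp_sub sA A_sub sf mup fup).
have AZw := A_eq0 _ (measurable_cond_exp_sub sA A_sub sf mwq fwq).
have zero_of (g : X -> R[i]) (a : R) Z : 0 < a -> cmeasurable g -> A Z ->
    {ae mu, forall x, Z x -> (normc (g x) `^ a)%:E = 0%E} ->
    {ae mu, forall x, Z x -> g x = 0}.
  move=> a0 mg AZ; apply: filterS => x + Zx => /(_ Zx)[/eqP].
  by rewrite powR_eq0 => /andP[/eqP/ComplexField.Normc.eq0_normc].
have Tu : {ae mu, forall x, (B `&` [set x | Eu x = 0%E]) x -> cLspace_fun (T f) x = 0}.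
  apply: (WCE_eq0_u sA A_sub sf T_WCE); first exact: AZu.
  apply: (zero_of _ _ _ p'0 u_meas AZu).
  by apply/(cond_exp_eq0 sA A_sub sf mup fup AZu); apply: aeW => x [].
have Tw : {ae mu, forall x, (B `&` [set x | Ew x = 0%E]) x -> cLspace_fun (T f) x = 0}.
  apply: (WCE_eq0_w T_WCE).
  apply: (zero_of _ _ _ q0 w_meas AZw).
  by apply/(cond_exp_eq0 sA A_sub sf mwq fwq AZw); apply: aeW => x [].
apply: (filter_app _ _ EB); apply: (filter_app _ _ Tu); apply: (filter_app _ _ Tw).
apply: aeW => x Twx Tux EBx Bx.
have /eqP := EBx Bx; rewrite mule_eq0 => /orP[] /eqP Ex.
- have Eux := poweR_eq0_eq0 (Eu0 x) Ex.
  by apply: Tux; split; [exact: Bx|exact: Eux].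
- have Ewx := poweR_eq0_eq0 (Ew0 x) Ex.
  by apply: Twx; split; [exact: Bx|exact: Ewx].
Qed.

Variables (I : set nat) (At : nat -> set X) (B : set X).
Hypotheses (At_atom : forall i, I i -> atom mu A (At i)) (At_disj : trivIset I At).
Hypotheses (AB : A B) (AtB_cover : (\bigcup_(i in I) At i) `|` B = [set: X]).

Let s i := (((fine (mu (At i)))^-1)%:E *
  ((\int[mu]_(x in At i) (normc (u x) `^ p')%:E) `^ p'^-1 *
   (\int[mu]_(x in At i) (normc (w x) `^ q)%:E) `^ q^-1))%E.

Lemma WCE_nuclear :
    {ae mu, forall x, B x -> (Eu x `^ p'^-1 * Ew x `^ q^-1 = 0)%E} ->
  (\esum_(i in I) s i < +oo)%E -> nuclear T.
Proof.
move=> /(WCE_eq0_cond_exp AB) TB.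
have s0 i : (0 <= (if i \in I then s i else 0))%E.
  case: ifPn => // _; rewrite /s !mule_ge0 ?poweR_ge0// lee_fin invr_ge0.
rewrite esum_mkcond -nneseries_esumT// => soo.
have sioo i : i \in I -> (s i < +oo)%E.
  move=> iI; apply: le_lt_trans soo.
  apply: le_trans (nneseries_lim_ge i.+1 _) => //.
  by rewrite big_nat_recr//= iI leeDr// sume_ge0.
pose C i := if i \in I then At i else set0.
have AC i : A (C i).
  rewrite /C; case: ifPn; first by rewrite inE => /At_atom[].
  by rewrite -(measurable_subE sA).
have mC i := A_sub (AC i).
have tC : trivIset setT C by have := At_disj; rewrite trivIset_mkcond.
have CB : \bigcup_i C i `|` B = setT.
  by rewrite -AtB_cover [in RHS]bigcup_mkcond.
have /choice[phi /choice[z phiz]] i :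
    exists (phi : {linear cLspace mu p1 -> R[i]^o}) (z : cLspace mu q1),
    [/\ bounded_op phi,
        ((op_norm phi * rnorm z)%:E <= 2%:E * (if i \in I then s i else 0))%E &
        forall f, restr (mC i) (T f) = (phi f : R[i]) *: z].
  have [iI|iI] := boolP (i \in I).
    have CE : C i = At i by rewrite /C iI.
    have aC : atom mu A (C i) by rewrite CE; apply: At_atom; rewrite -in_setE.
    have [|ph [zi [b1 b2 b3]]] :=
        atom_rank_one sA A_sub sf p_gt1 pp' w_meas u_meas T_WCE (mC i) aC.
      by rewrite CE; exact: sioo.
    exists ph, zi; split; [exact: b1| |exact: b3].
    by move: b2; rewrite CE.
  exists \0, 0; split.
  - by exists 0 => y; rewrite normr0 mul0r.
  - by rewrite rnorm0 mulr0 mule0.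
  - move=> f; rewrite scaler0; apply: restr_eq0; apply: aeW => x.
    by rewrite /C (negPf iI).
exists phi, z; split.
- by move=> n; case: (phiz n).
- apply: (@le_lt_trans _ _ (\sum_(i <oo) 2%:E * (if i \in I then s i else 0))%E).
    apply: lee_nneseries => [i _ _|i _]; last by case: (phiz i).
    by rewrite lee_fin mulr_ge0 ?rnorm_ge0// op_norm_ge0//; case: (phiz i).
  by rewrite nneseriesZl// lte_mul_pinfty// lee_fin.
- move=> f.
  have -> : (fun n => (phi n f : R[i]) *: z n) = (fun n => restr (mC n) (T f)).
    by apply/funext => n; case: (phiz n).
  by apply: (restr_series_cvg _ tC CB (TB f)).
Qed.

End sufficiency.

Local Close Scope complex_scope.

Theorem theorem2p9 (R : realType) (d : measure_display) (X : measurableType d)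
  (mu : {measure set X -> \bar R})
  (mu_complete : measure_is_complete mu)
  (mu_sigma_finite : sigma_finite [set: X] mu)
  (A : set (set X))
  (A_sigma_algebra : sigma_algebra [set: X] A)
  (A_sub : A `<=` measurable)
  (muA_sigma_finite : sigma_finite [set: g_sigma_algebraType A] mu)
  (I : set nat) (At : nat -> set X) (B : set X)
  (At_atom : forall i, I i -> atom mu A (At i))
  (At_disj : trivIset I At)
  (AB : A B)
  (B_nonatomic : nonatomic mu A B)
  (AtB_disj : (\bigcup_(i in I) At i) `&` B = set0)
  (AtB_cover : (\bigcup_(i in I) At i) `|` B = [set: X])
  (p q p' r : R) (p1 : 1 <= p) (q1 : 1 <= q) (qp : q < p)
  (pp' : p^-1 + p'^-1 = 1) (pqr : p^-1 + r^-1 = q^-1)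
  (w u : X -> R[i]) (w_meas : cmeasurable w) (u_meas : cmeasurable u)
  (T : {linear cLspace mu p1 -> cLspace mu q1})
  (T_WCE : is_WCE A w u T) (T_bounded : bounded_op T) :
  let Eu := cond_exp mu A (fun x => (normc (u x) `^ p')%:E) in
  let Ew := cond_exp mu A (fun x => (normc (w x) `^ q)%:E) in
  nuclear T <->
    {ae mu, forall x, B x -> (Eu x `^ p'^-1 * Ew x `^ q^-1 = 0)%E} /\
    (\esum_(i in I) (atom_value mu Eu (At i) `^ p'^-1 *
                     atom_value mu Ew (At i) `^ q^-1 *
                     mu (At i) `^ r^-1) < +oo)%E.
Proof.
move=> Eu Ew; have p_gt1 : 1 < p by exact: le_lt_trans q1 qp.
(* Both directions work with this form of (ii), which is free of conditional expectations. *)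
have term i : I i -> (atom_value mu Eu (At i) `^ p'^-1 *
    atom_value mu Ew (At i) `^ q^-1 * mu (At i) `^ r^-1 =
    ((fine (mu (At i)))^-1)%:E *
    ((\int[mu]_(x in At i) (normc (u x) `^ p')%:E) `^ p'^-1 *
     (\int[mu]_(x in At i) (normc (w x) `^ q)%:E) `^ q^-1))%E.
  move=> /At_atom; apply: (atom_termE A_sigma_algebra A_sub muA_sigma_finite pp' pqr).
  - exact/measurable_EFinP/measurable_normcX.
  - exact/measurable_EFinP/measurable_normcX.
  - by move=> x; exact: powR_ge0.
  - by move=> x; exact: powR_ge0.
rewrite (eq_esum term); split => [Tn|[EB soo]]; last first.
  exact: (WCE_nuclear A_sigma_algebra A_sub muA_sigma_finite p_gt1 pp' w_meas u_meas T_WCE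
    At_atom At_disj AB AtB_cover EB soo).
split.
  exact: (nuclear_nonatomic A_sigma_algebra A_sub muA_sigma_finite qp pp' w_meas u_meas T_WCE Tn).
have [N NP] := nuclear_atoms_bound A_sigma_algebra A_sub muA_sigma_finite qp pp'
  w_meas u_meas T_WCE Tn At_atom At_disj.
(* The sum over [I] becomes a series over [nat] with zero terms outside [I], whose partial sums are
   those of [nuclear_atoms_bound]. *)
rewrite esum_mkcond -nneseries_esumT; last first.
  move=> i; case: ifPn => // _; rewrite !mule_ge0 ?poweR_ge0// lee_fin invr_ge0.
apply: (@le_lt_trans _ _ N%:E); last by rewrite ltry.
apply: lime_le.
  apply: is_cvg_nneseries => i _ _.
  case: ifPn => // _; rewrite !mule_ge0 ?poweR_ge0// lee_fin invr_ge0.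
by apply: nearW => k; rewrite big_mkord; exact: NP.
Qed.
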